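(* The dimension of the centered realization space of the 24-cell $C_4^{(24)}$ satisfies $$48\le\dim\mathcal{R}_{\mathbf 0}(C_4^{(24)})\le 52.$$
   Context: The 24-cell $C_4^{(24)}$ is the (combinatorial type of the) regular $4$-polytope $\operatorname{conv}\{\pm\mathbf e_i\pm\mathbf e_j\mid 1\le i<j\le 4\}\subset\mathbb{R}^4$; it has $24$ vertices, $24$ (octahedral) facets and $144$ vertex-facet incidences. For a labeled $d$-polytope $P$ (vertices and facets numbered) with $n$ vertices and $m$ facets, a labeled $d$-polytope $Q\subset\mathbb{R}^d$ realizes $P$ if there is an isomorphism between the face lattices of $P$ and $Q$ respecting the labels of vertices and facets. The centered realization space is the semi-algebraic set $$\mathcal{R}_{\mathbf 0}(P)=\{(V,A)\in\mathbb{R}^{d\times(n+m)} \mid \operatorname{conv}(V)=\{\mathbf x\in\mathbb{R}^d\mid A^t\mathbf x\le\mathbf 1\}\text{ realizes }P\},$$ where $\operatorname{conv}(V)$ is the convex hull of the columns of $V$; $\dim$ denotes its dimension as a semi-algebraic set. *)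

(* Defs.v *)
From mathcomp Require Import all_boot all_order all_algebra.
From mathcomp Require Import boolp classical_sets reals.
From mathcomp Require Import mpoly.

Set Implicit Arguments.
Unset Strict Implicit.
Unset Printing Implicit Defensive.

Import Order.TTheory GRing.Theory Num.Theory.

Local Open Scope classical_set_scope.
Local Open Scope ring_scope.

Section Polytopes.
Variables (R : realType) (d : nat).
Implicit Types (S Q F G : set 'cV[R]_d).

Definition dotv (c x : 'cV[R]_d) : R := (c^T *m x) ord0 ord0.

Definition conv_hull S : set 'cV[R]_d :=
  [set x | exists k (p : 'I_k -> 'cV[R]_d) (w : 'I_k -> R),
     [/\ forall i, S (p i), forall i, 0 <= w i, \sum_i w i = 1
       & x = \sum_i w i *: p i]].

Definition conv n (V : 'M[R]_(d, n)) : set 'cV[R]_d :=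
  conv_hull (range (fun i => col i V)).

Definition polyhedron m (A : 'M[R]_(d, m)) : set 'cV[R]_d :=
  [set x | forall j, (A^T *m x) j ord0 <= 1].

Definition aff_indep k (p : 'I_k -> 'cV[R]_d) : Prop :=
  forall w : 'I_k -> R,
    \sum_i w i = 0 -> \sum_i w i *: p i = 0 -> forall i, w i = 0.

(* k is the dimension of the affine hull of the (nonempty) set S. *)
Definition aff_dim S (k : nat) : Prop :=
  (exists p : 'I_k.+1 -> 'cV[R]_d, (forall i, S (p i)) /\ aff_indep p) /\
  (forall p : 'I_k.+2 -> 'cV[R]_d, (forall i, S (p i)) -> ~ aff_indep p).

(* The improper faces are included: c = 0 gives Q for b = 0 and the empty
   face for b = 1. *)
Definition is_face Q F : Prop :=
  exists (c : 'cV[R]_d) (b : R),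
    (forall x, Q x -> dotv c x <= b) /\ F = [set x | Q x /\ dotv c x = b].

Definition is_vertex Q (v : 'cV[R]_d) : Prop := is_face Q [set v].

Definition is_facet Q F : Prop :=
  is_face Q F /\ exists k, aff_dim F k /\ aff_dim Q k.+1.

(* The polytope conv V is d-dimensional, its vertices are numbered by the
   columns of V, and its facets by F. *)
Definition labeled_polytope n m
    (V : 'M[R]_(d, n)) (F : 'I_m -> set 'cV[R]_d) : Prop :=
  [/\ aff_dim (conv V) d,
      injective (fun i => col i V),
      forall v, is_vertex (conv V) v <-> exists i, v = col i V,
      injective F
    & forall G, is_facet (conv V) G <-> exists j, G = F j].

Definition face_lattice_iso Q Q' (phi : set 'cV[R]_d -> set 'cV[R]_d) : Prop :=
  [/\ forall F, is_face Q F -> is_face Q' (phi F),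
      forall F G, is_face Q F -> is_face Q G ->
        (phi F `<=` phi G <-> F `<=` G)
    & forall F', is_face Q' F' -> exists2 F, is_face Q F & phi F = F'].

(* The labeled polytope (V', F') realizes the labeled polytope (V, F). *)
Definition realizes n m
    (V' : 'M[R]_(d, n)) (F' : 'I_m -> set 'cV[R]_d)
    (V : 'M[R]_(d, n)) (F : 'I_m -> set 'cV[R]_d) : Prop :=
  labeled_polytope V' F' /\
  exists phi, [/\ face_lattice_iso (conv V) (conv V') phi,
                  forall i, phi [set col i V] = [set col i V']
                & forall j, phi (F j) = F' j].

(* The facet of Q = conv V labeled j is the one cut out by the j-th
   inequality of A^T x <= 1. *)
Definition facet_of_col Q m (A : 'M[R]_(d, m)) (j : 'I_m) : set 'cV[R]_d :=
  [set x | Q x /\ (A^T *m x) j ord0 = 1].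

(* A point of R^(d x (n + m)) is the block matrix (V, A). *)
Definition centered_realization_space n m
    (V0 : 'M[R]_(d, n)) (F0 : 'I_m -> set 'cV[R]_d) :
    set 'M[R]_(d, n + m) :=
  [set M | let V := lsubmx M in let A := rsubmx M in
     conv V = polyhedron A /\ realizes V (facet_of_col (conv V) A) V0 F0].

End Polytopes.

Definition cell24 (R : realType) : set 'cV[R]_4 :=
  conv_hull [set x | exists (i j : 'I_4) (s t : bool), (i < j)%N /\
    x = (-1) ^+ s *: delta_mx i ord0 + (-1) ^+ t *: delta_mx j ord0].

Section Dimension.

Definition prime_ideal (A : comNzRingType) (P : {pred A}) : Prop :=
  idealr_closed P /\ prime_idealr_closed P.

(* P_0 < P_1 < ... < P_l are prime ideals of A containing I; equivalently, a
   chain of length l of prime ideals of the quotient A / I. *)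
Definition prime_chain (A : comNzRingType) (I : set A) (l : nat)
    (P : 'I_l.+1 -> {pred A}) : Prop :=
  [/\ forall k, prime_ideal (P k),
      forall k a, I a -> a \in P k
    & forall j k : 'I_l.+1, (j < k)%N ->
        {subset P j <= P k} /\ exists2 a, a \in P k & a \notin P j].

Definition quotient_krull_dim (A : comNzRingType) (I : set A) (l : nat) : Prop :=
  (exists P : 'I_l.+1 -> {pred A}, prime_chain I P) /\
  (forall l' (P : 'I_l'.+1 -> {pred A}), prime_chain I P -> (l' <= l)%N).

Variables (R : realType) (N : nat).

Definition vanishing_ideal (S : set 'rV[R]_N) : set {mpoly R[N]} :=
  [set p | forall x, S x -> p.@[fun i => x ord0 i] = 0].

(* The dimension of a semi-algebraic set S (Bochnak-Coste-Roy, Real Algebraic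
   Geometry, Definition 2.8.1) is the Krull dimension of the ring of polynomial
   functions R[X_1, ..., X_N] / I(S) on S. *)
Definition semialg_dim (S : set 'rV[R]_N) (l : nat) : Prop :=
  quotient_krull_dim (vanishing_ideal S) l.

End Dimension.

(* Main.v *)
Require Import Defs.
From HB Require Import structures.
From Stdlib Require Import ZArith.
From mathcomp Require Import all_boot all_order all_algebra.
From mathcomp Require Import boolp classical_sets functions reals.
From mathcomp Require Import ssrZ zify ring lra.
From mathcomp Require topology normedtype sequences interval_inference.
From mathcomp Require mpoly.

Set Implicit Arguments.
Unset Strict Implicit.
Unset Printing Implicit Defensive.

Import Order.TTheory GRing.Theory Num.Theory.

Local Open Scope classical_set_scope.
Local Open Scope ring_scope.

(** Let [S] be the set of pairs [(V, A)] of 24 vectors [v_i] and 24 vectors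
    [a_j] of R^4 with [a_j . v_i = 1] for the 144 vertex-facet incidences and
    [a_j . v_i < 1] for all other pairs.  The centered realization space is [S]
    itself.  One inclusion reads the incidences off the isomorphism of face
    lattices.  For the other one, [conv V] must be the polyhedron of [A].  This
    is a local matter: the vertex figures of the 24-cell are cubes, hence simple
    polytopes, and therefore a functional that is maximal at [v_i] among the
    vertices is a nonnegative combination of the facet normals at [v_i]
    ([local_max]).  So no vertex and no facet is missing ([conv_eq_polyhedron]);
    every face is an intersection of facets ([is_face_facets]), so that the
    incidences determine the face lattice ([centered_realization_spaceE]).

    The dimension of [S] is the largest length of a chain of prime ideals above
    the vanishing ideal of [S], and there are 192 coordinates and 144 equations.

    At most 52.  List the 48 vectors in the order of [construction24].  There
    each of them comes with at most four earlier ones that are incident to it and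
    that are linearly independent at every point of [S], for a combinatorial
    reason ([peelable]).  So it solves a linear system with coefficients
    among the earlier vectors and is determined by as many of its coordinates as
    there are equations short of four.  This uses 140 of the 144 incidences, and
    leaves 52 free coordinates, of which all 192 are rational functions.  Which
    coordinates are free depends on the point, but there are finitely many
    possibilities, the charts.  On a chart any 53 polynomials satisfy a
    polynomial relation, since products of powers outnumber monomials in 52
    variables ([rational_dependent]).  A chain of primes of length 53 forbids
    that: take one polynomial from each step, and look at the
    lexicographically trailing monomial of the relation ([relation_notin]).
    Primality selects one chart from the product of the relations of all charts
    ([chain_length_le]).

    At least 48.  At a point of [S] where the 144 equations have independent
    differentials, [S] is locally a manifold of dimension 192 - 144 = 48.  The
    regular 24-cell is not such a point, for its Jacobian matrix has rank 140
    only.  But there are less symmetric rational realizations whose Jacobian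
    matrix has rank 144, and one is given by [vertex_gen] and [facet_gen]; in
    other words, it carries no self-stress.  Near it one can move inside [S] in
    any prescribed tangent direction ([solve_in_direction]).  Hence for
    48 linear forms that are coordinates on the tangent space no
    element of a certain monoid built from the forms ([flag_monoid]) vanishes on
    [S], and this is the condition under which a chain of primes of length 48
    exists ([prime_chain_of_flag]). *)

(** * Fixed points of contractions *)

Definition near_pt (R : realType) N (q : 'rV[R]_N) (r : R) : set 'rV[R]_N :=
  [set x | forall i, `|x ord0 i - q ord0 i| <= r].

Module Contraction.
Import interval_inference topology normedtype sequences numFieldNormedType.Exports.

HB.instance Definition _ (R : realType) (m n : nat) :=
  Uniform_isComplete.Build 'M[R]_(m, n) (@mx_complete R m n).

Lemma norm_le_coord (R : realType) N (x : 'rV[R]_N) (b : R) : 0 <= b ->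
  (`|x| <= b) <-> (forall i, `|x ord0 i| <= b).
Proof.
move=> b0; rewrite [`|x|]mx_normrE; split=> [h i|h].
  by move/bigmax_leP: h => [_ /(_ (ord0, i) isT)].
by apply/bigmax_leP; split=> // -[i j] _ /=; rewrite ord1.
Qed.

(** The map has contraction factor 1/2 for the supremum norm and moves the
    centre by at most half the radius, so it maps the ball to itself. *)
Lemma contraction_fixpoint (R : realType) N (T : 'rV[R]_N -> 'rV[R]_N)
    (q : 'rV[R]_N) (r : R) : 0 <= r ->
  (forall x y b, near_pt q r x -> near_pt q r y -> near_pt y b x ->
     near_pt (T y) (b / 2) (T x)) ->
  near_pt q (r / 2) (T q) ->
  exists2 x, near_pt q r x & T x = x.
Proof.
move=> r0 Tc Tq.
have nearE (x y : 'rV[R]_N) b : 0 <= b -> near_pt y b x <-> `|x - y| <= b.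
  move=> b0; rewrite norm_le_coord //.
  by split=> h i; move: (h i); rewrite !mxE.
have qq : near_pt q r q by move=> i; rewrite subrr normr0.
have Tfun : {homo T : x / near_pt q r x >-> near_pt q r x}.
  move=> x qx i /=.
  have := Tc _ _ r qx qq qx i; have := Tq i => h1 h2.
  rewrite -(subrK (T q ord0 i) (T x ord0 i)) -addrA.
  by rewrite (le_trans (ler_normD _ _)) // [r]splitr lerD.
have half0 : 0 <= 2^-1 :> R by rewrite invr_ge0.
have ctr : is_contraction (mkfun_fun Tfun).
  exists (NngNum half0); split=> /=; first by rewrite invf_lt1 ?ltr1n.
  move=> [x y] [qx qy] /=; rewrite -[X in _ <= X]mulrC.
  apply/nearE; first by rewrite mulr_ge0.
  by apply: Tc => //; apply/nearE.
have cl : closed (near_pt q r).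
  have -> : near_pt q r = closed_ball_ Num.norm q r; last exact: closed_closed_ball_.
  by apply/seteqP; split=> x; rewrite /closed_ball_ /= nearE // distrC.
have [x qx xT] := @banach_fixed_point R 'rV[R]_N _ _ ctr cl (ex_intro _ q qq).
by exists x.
Qed.
End Contraction.

Import mpoly.

(** * Existence of chains of prime ideals *)

Section PrimeChains.
Variable A : comNzRingType.
Implicit Types (I J M : set A) (xs : seq A) (P : {pred A}).

Definition ideal I := I 0 /\ forall a u v, I u -> I v -> I (a * u + v).

Definition add_gen I x : set A := [set u | exists a i, I i /\ u = a * x + i].

Lemma add_gen_ideal I x : ideal I -> ideal (add_gen I x).
Proof.
move=> [I0 Iadd]; split; first by exists 0, 0; rewrite mul0r addr0.
move=> c _ _ [a [i [Ii ->]]] [b [j [Ij ->]]].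
by exists (c * a + b), (c * i + j); split; [exact: Iadd|ring].
Qed.

Lemma sub_add_gen I x : I `<=` add_gen I x.
Proof. by move=> i Ii; exists 0, i; rewrite mul0r add0r. Qed.

Lemma mem_add_gen I x : ideal I -> add_gen I x x.
Proof. by move=> [I0 _]; exists 1, 0; rewrite mul1r addr0. Qed.

Definition monoid M := M 1 /\ forall u v, M u -> M v -> M (u * v).

(** An ideal that is maximal among those that contain [I] and avoid the monoid
    is prime: adding either of two elements outside it produces a member of the
    monoid, and the product of these members would lie in the ideal as soon as
    the product of the two elements does. *)
Lemma prime_avoiding I M : ideal I -> monoid M -> (forall x, I x -> ~ M x) ->
  exists P, [/\ prime_ideal P, forall x, I x -> x \in P
              & forall x, M x -> x \notin P].
Proof.
move=> idI [M1 Mmul] IM.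
(* The union with I makes the statement hold for the empty chain, too. *)
have [|J [[idK KM] Jmax]] := @Zorn_bigcup A
    [set J | ideal (I `|` J) /\ forall x, (I `|` J) x -> ~ M x].
  move=> F FP Ftot; split.
    split; first by left; case: idI.
    move=> a u v.
    have pick J : F J -> (I `|` J) u -> (I `|` J) v ->
        (I `|` \bigcup_(X in F) X) (a * u + v).
      move=> FJ uJ vJ; have [[_ /(_ a u v uJ vJ) []]] := FP _ FJ; first by left.
      by right; exists J.
    case=> [Iu|[J FJ Ju]] [Iv|[J' FJ' Jv]].
    - by left; case: idI => _; apply.
    - by apply: (pick J') => //; [left|right].
    - by apply: (pick J) => //; [right|left].
    - have [JJ'|J'J] := Ftot _ _ FJ FJ'.
        by apply: (pick J') => //; right => //; apply: JJ'.
      by apply: (pick J) => //; right => //; apply: J'J.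
  move=> x [Ix|[J FJ Jx]]; first exact: IM.
  by have [_] := FP _ FJ; apply; right.
pose K := I `|` J.
have meetM b : ~ K b -> exists a i, K i /\ M (a * b + i).
  move=> Kb; apply: contrapT => noM.
  have idK' := add_gen_ideal b idK.
  have IK' : I `|` add_gen K b = add_gen K b.
    by apply/setUidPr => x Ix; apply: sub_add_gen; left.
  apply: (Jmax (add_gen K b)).
    split; last first.
      by move=> /(_ b (mem_add_gen b idK)) Jb; apply: Kb; right.
    by move=> x Jx; apply: sub_add_gen; right.
  split; rewrite IK' // => x [a [i [Ki ->]]] Mx.
  by apply: noM; exists a, i.
exists (fun x => `[< K x >]); split.
- split; last first.
    move=> u v /asboolP Kuv; apply: contrapT => /negP.
    rewrite negb_or !unfold_in => /andP[/asboolPn /meetM [a [i [Ki Mi]]]].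
    move=> /asboolPn /meetM [b [j [Kj Mj]]].
    apply: (KM _ _ (Mmul _ _ Mi Mj)).
    have -> : (a * u + i) * (b * v + j) =
        (a * b) * (u * v) + ((a * u + i) * j + (b * v * i + 0)) by ring.
    case: idK => K0 Kadd.
    by apply: (Kadd) => //; apply: (Kadd) => //; apply: (Kadd).
  split; first by apply/asboolP; case: idK.
    by apply/asboolP => /KM; apply.
  move=> a u v /asboolP Ku /asboolP Kv; apply/asboolP.
  by case: idK => _; apply.
- by move=> x Ix; apply/asboolP; left.
- by move=> x Mx; apply/asboolP => /KM; apply.
Qed.

(** For [xs = x_0, ..., x_(k-1)] these are the elements
    [x_0^e_0 (x_1^e_1 ( ... (x_(k-1)^e_(k-1) (1 + a_(k-1) x_(k-1))) ... ) + a_0 x_0)].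
    A ring has Krull dimension below [k] exactly when 0 is such an element for
    every [xs] of length [k] (Coquand and Lombardi). *)
Fixpoint flag_monoid xs : set A :=
  if xs is x :: xs' then
    [set u | exists e a m, flag_monoid xs' m /\ u = x ^+ e * (m + a * x)]
  else [set 1].

Lemma flag_monoidP xs : monoid (flag_monoid xs).
Proof.
elim: xs => [|x xs [IH1 IHM]] /=; first by split=> // u v -> ->; rewrite mulr1.
split; first by exists 0%N, 0, 1; rewrite expr0 mul1r mul0r addr0.
move=> _ _ [e [a [m [Mm ->]]]] [f [b [m' [Mm' ->]]]].
exists (e + f)%N, (m * b + a * m' + a * b * x), (m * m').
by split; [exact: IHM|rewrite exprD; ring].
Qed.

(** A prime [P0] above [I] that avoids the monoid of [x :: xs] does not contain
    [x], and the ideal generated by [P0] and [x] avoids the monoid of [xs]: if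
    [a x + i] with [i] in [P0] were in the latter, then [i = (a x + i) - a x]
    would be in the former.  So the construction goes on above [P0 + (x)]. *)
Lemma prime_chain_of_flag xs I : ideal I ->
  (forall x, I x -> ~ flag_monoid xs x) ->
  exists P : 'I_(size xs).+1 -> {pred A}, prime_chain I P.
Proof.
elim: xs I => [|x xs IH] I idI Iflag.
  have [P [primeP IP _]] := prime_avoiding idI (flag_monoidP [::]) Iflag.
  exists (fun=> P); split=> // j k; by rewrite !ord1.
have [P0 [primeP0 IP0 flagP0]] := prime_avoiding idI (flag_monoidP (x :: xs)) Iflag.
have idP0 : ideal [set u | u \in P0].
  case: primeP0 => -[? _ addP] _; split=> // a u v; exact: addP.
have [|u [a [i [/= P0i ->]]] Mu|P [primeP genP chainP]] := IH (add_gen [set u | u \in P0] x).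
- exact: add_gen_ideal.
- suff /flagP0 : flag_monoid (x :: xs) i by rewrite P0i.
  by exists 0%N, (- a), (a * x + i); split=> //; rewrite expr0; ring.
exists (fun k => if unlift ord0 k is Some k' then P k' else P0); split.
- by move=> k; case: unliftP.
- move=> k b Ib; case: unliftP => [k' _|_]; last exact: IP0.
  by apply: genP; apply: sub_add_gen; exact: IP0.
- move=> j k; case: (unliftP ord0 k) => [k' ->|->]; last by rewrite ltn0.
  case: (unliftP ord0 j) => [j' ->|->]; first by rewrite !lift0 ltnS; exact: chainP.
  move=> _; split=> [b P0b|]; first by apply: genP; apply: sub_add_gen.
  exists x; first by apply: genP; apply: mem_add_gen.
  apply: flagP0; exists 1%N, 0, 1; rewrite expr1 mul0r addr0 mulr1; split=> //.
  by case: (flag_monoidP xs).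
Qed.

End PrimeChains.

(** * Length of chains and algebraic relations *)

Section Relations.
Variables (K : fieldType).

(** A polynomial is given by its list of exponent vectors and coefficients,
    because the trailing monomial is found by recursion on the variables. *)
Definition relation := seq (seq nat * K).

Definition relation_wf (n : nat) (s : relation) : bool :=
  [&& s != [::], uniq (map fst s), all (fun t => size t.1 == n) s
    & all (fun t => t.2 != 0) s].

Fixpoint monom (A : comNzRingType) (fs : seq A) (e : seq nat) : A :=
  match fs, e with
  | f :: fs', a :: e' => f ^+ a * monom fs' e'
  | _, _ => 1
  end.

Variable A : comAlgType K.

Definition eval_relation (fs : seq A) (s : relation) : A :=
  \sum_(t <- s) t.2 *: monom fs t.1.

Lemma primeX (P : {pred A}) (x : A) k : prime_ideal P -> x \notin P -> x ^+ k \notin P.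
Proof.
move=> [[_ P1 _] primeP] xP; elim: k => [|k IH]; first by rewrite expr0.
by apply/negP; rewrite exprS => /primeP; rewrite (negPf xP) (negPf IH).
Qed.

(** Let [m] be the least exponent of the first element [f] in the relation, so
    that the relation is [f^m (g + f X)] where [g] involves only the remaining
    elements.  If it is in [P 0], then [g + f X] is in [P 0], because [f] is not;
    so [g] is in [P 1], because [f] is.  After the last element [g] has become a
    nonzero constant. *)
Lemma relation_notin (fs : seq A) (P : nat -> {pred A}) (s : relation) :
  (forall k, (k <= size fs)%N -> prime_ideal (P k)) ->
  (forall k, (k < size fs)%N ->
     [/\ {subset P k <= P k.+1}, fs`_k \in P k.+1 & fs`_k \notin P k]) ->
  relation_wf (size fs) s -> eval_relation fs s \notin P 0%N.
Proof.
elim: fs P s => [|f fs IH] P s primeP chainP /and4P[s0 us szs nzs].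
  have [[P0 P1 Padd] _] := primeP 0%N (leqnn _).
  case: s s0 us szs nzs => // -[e c] [|[e' c'] s] //= _; last first.
    rewrite inE negb_or => /andP[/andP[ee' _] _] /and3P[/eqP/size0nil e0 /eqP/size0nil e'0 _].
    by rewrite e0 e'0 eqxx in ee'.
  move=> _ _ /andP[c0 _]; apply/negP; rewrite /eval_relation big_seq1 /= => cP.
  have := Padd (c^-1)%:A (c *: 1) 0 cP P0.
  by rewrite addr0 -scalerAl mul1r scalerA mulVf // scale1r (negPf P1).
have [t0 t0s t0min] : exists2 t, t \in s & all (fun u => (head 0%N t.1 <= head 0%N u.1)%N) s.
  have exk : exists k, has (fun u => head 0%N u.1 == k) s.
    by case: s s0 {us szs nzs} => // u s _; exists (head 0%N u.1); rewrite /= eqxx.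
  case: (ex_minnP exk) => k /hasP[t ts /eqP tk] kmin.
  exists t => //; apply/allP => u us'; rewrite tk; apply: kmin.
  by apply/hasP; exists u.
(* g is the relation s' formed by the terms in which f has exponent m. *)
set m := head 0%N t0.1 in t0min.
pose s' := [seq (behead t.1, t.2) | t <- s & head 0%N t.1 == m].
have wf' : relation_wf (size fs) s'.
  apply/and4P; split.
  - have : (behead t0.1, t0.2) \in s' by apply: map_f; rewrite mem_filter eqxx.
    by case: s'.
  - rewrite -map_comp map_inj_in_uniq; first exact/filter_uniq/(map_uniq us).
    move=> [e c] [e' c']; rewrite !mem_filter /= => /andP[/eqP em es] /andP[/eqP e'm e's] ee'.
    have {}ee' : e = e'.
      have /allP szs' := szs.
      have /= := szs' _ es; have /= := szs' _ e's; move: em e'm ee'.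
      by case: (e) => [|x z] //; case: (e') => [|x' z'] //= -> -> ->.
    rewrite -ee' in e's *; congr (_, _).
    have /(_ (e, c) (e, c') es e's erefl) [] // : {in s &, injective fst}.
      move=> u v us' vs' /= uv; have := us => /(uniqP (nth [::] (map fst s) 0)).
      move=> /(_ (index u s) (index v s)); rewrite !inE size_map !index_mem us' vs'.
      move=> /(_ isT isT).
      rewrite !(nth_map u) ?index_mem // !nth_index // => /(_ uv) iuv.
      by rewrite -(nth_index u us') iuv nth_index.
  - apply/allP => _ /mapP[t + ->] /=; rewrite mem_filter => /andP[_ ts].
    by move: (allP szs _ ts); rewrite size_behead => /eqP->.
  - apply/allP => _ /mapP[t + ->] /=; rewrite mem_filter => /andP[_ ts].
    exact: (allP nzs _ ts).
have /= [subP fP1 fP0] := chainP 0%N (ltn0Sn _).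
apply/negP => sP.
pose X := \sum_(t <- s | head 0%N t.1 != m)
  t.2 *: (f ^+ (head 0%N t.1 - m).-1 * monom fs (behead t.1)).
have sE : eval_relation (f :: fs) s = f ^+ m * (eval_relation fs s' + f * X).
  rewrite /eval_relation big_map big_filter mulrDr !mulr_sumr.
  rewrite (bigID (fun t => head 0%N t.1 == m)) /=; congr (_ + _).
    rewrite big_seq_cond [RHS]big_seq_cond; apply: eq_bigr => -[[|a e] c] /=.
      by move=> /andP[/(allP szs)].
    by move=> /andP[_ /eqP->]; rewrite scalerAr.
  rewrite big_seq_cond [RHS]big_seq_cond; apply: eq_bigr => -[[|a e] c] /=.
    by move=> /andP[/(allP szs)].
  move=> /andP[ts am]; rewrite -!scalerAr !mulrA -exprSr -exprD; congr (_ *: (f ^+ _ * _)).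
  have /= := allP t0min _ ts; rewrite leq_eqVlt eq_sym (negPf am) /= => ma.
  by rewrite addSnnS prednK ?subn_gt0 // subnKC // ltnW.
have [_ prime0] := primeP 0%N (leq0n _).
have [[_ _ add1] _] := primeP 1%N (ltn0Sn _).
have inP1 : eval_relation fs s' + f * X \in P 1%N.
  apply: subP; move: sP; rewrite sE => /prime0; rewrite (negPf (primeX _ _ fP0)) //.
  exact: (primeP 0%N).
have /negP := IH (fun k => P k.+1) s' (fun k kn => primeP k.+1 kn)
  (fun k kn => chainP k.+1 kn) wf'; apply.
by have := add1 (- X) _ _ fP1 inP1; rewrite mulNr (mulrC X) addrC addrK.
Qed.

End Relations.

Lemma prime_prod (A : comNzRingType) (P : {pred A}) (I : finType) (F : I -> A) :
  prime_ideal P -> \prod_i F i \in P -> exists i, F i \in P.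
Proof.
move=> [[_ P1 _] primeP].
elim/big_rec: _ => [|i x _ IH /primeP /orP[|//]]; first by rewrite (negPf P1).
by exists i.
Qed.

(** One polynomial out of each of the first [r.+1] steps of the chain gives a
    family that satisfies a relation on each chart.  The product of these
    relations over all charts vanishes on [S], so it is in the smallest prime of
    the chain, and so is the relation of some chart; [relation_notin] excludes
    this. *)
Lemma chain_length_le (R : realType) (N r : nat) (S : set 'rV[R]_N) (I : finType)
    (T : I -> set 'rV[R]_N) :
  (forall x, S x -> exists c, T c x) ->
  (forall c (fs : seq {mpoly R[N]}), size fs = r.+1 -> exists2 s : relation R,
     relation_wf r.+1 s &
     forall x, T c x -> (eval_relation fs s).@[fun i => x ord0 i] = 0) ->
  forall l (P : 'I_l.+1 -> {pred {mpoly R[N]}}),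
    prime_chain (vanishing_ideal S) P -> (l <= r)%N.
Proof.
move=> cover dep l P [primeP IP chainP]; rewrite leqNgt; apply/negP => rl.
have step (k : 'I_r.+1) : exists f, f \in P (inord k.+1) /\ f \notin P (inord k).
  have kl : (k < l)%N by rewrite (leq_trans (ltn_ord k)).
  have [|_ [f fk1 fk]] := chainP (inord k) (inord k.+1); last by exists f.
  by rewrite !inordK ?ltnS // ltnW.
have {step} [f fP] := choice step.
pose fs := [seq f i | i <- enum 'I_r.+1].
have szfs : size fs = r.+1 by rewrite size_map size_enum_ord.
have fsE k : (k < r.+1)%N -> fs`_k = f (inord k).
  move=> kr; rewrite (nth_map ord0) ?size_enum_ord //; congr f.
  by apply: val_inj; rewrite /= nth_enum_ord // inordK.
have [s sP] := choice (fun c => let: ex_intro2 s w e := dep c fs szfs in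
  ex_intro (fun s => relation_wf r.+1 s /\
     forall x, T c x -> (eval_relation fs s).@[fun i => x ord0 i] = 0) s (conj w e)).
have [|c] := @prime_prod _ (P (inord 0)) I (fun c => eval_relation fs (s c)) (primeP _).
  apply: IP => x /cover[c Tc]; rewrite rmorph_prod (bigD1 c) //= (sP c).2 // mul0r.
  by [].
apply/negP; apply: (@relation_notin _ _ fs (fun k => P (inord k))) => //.
  move=> k; rewrite szfs => kr; rewrite fsE //.
  have [/=] := fP (inord k); rewrite inordK // => f1 f0; split=> //.
  apply: (proj1 (chainP _ _ _)); rewrite !inordK ?ltnS //.
    by rewrite (leq_trans _ rl).
  by rewrite ltnW // (leq_trans kr).
by rewrite szfs; exact: (sP c).1.
Qed.

(** * Dependence of rational functions *)

Lemma monomE (K : fieldType) (A : comNzRingType) n (fs : seq A) (e : seq nat) :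
  size fs = n -> size e = n -> monom fs e = \prod_(i < n) fs`_i ^+ nth 0%N e i.
Proof.
elim: n fs e => [|n IH] [|f fs] [|a e] //= => [_ _|[sf] [se]]; first by rewrite big_ord0.
by rewrite big_ord_recl /= -IH.
Qed.

Section Rational.
Variables (R : realType) (r : nat) (X : Type) (T : set X) (g : X -> 'I_r -> R).

(** Rational functions of the parameters [g] are represented by a fraction whose
    denominator has no zero on [T], so that they can be evaluated everywhere on
    [T]. *)
Definition rational_on (h : X -> R) : Prop := exists p q : {mpoly R[r]},
  forall x, T x -> q.@[g x] != 0 /\ h x * q.@[g x] = p.@[g x].

Lemma rational_cst c : rational_on (fun=> c).
Proof.
by exists c%:MP, 1 => x _; rewrite meval1 mevalC mulr1 oner_neq0.
Qed.

Lemma rational_param i : rational_on (fun x => g x i).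
Proof. by exists 'X_i, 1 => x _; rewrite meval1 mevalXU mulr1 oner_neq0. Qed.

Lemma rational_ext h h' : (forall x, T x -> h x = h' x) -> rational_on h -> rational_on h'.
Proof. by move=> hh [p [q pq]]; exists p, q => x Tx; rewrite -hh //; exact: pq. Qed.

Lemma rationalD h h' : rational_on h -> rational_on h' -> rational_on (fun x => h x + h' x).
Proof.
move=> [p [q pq]] [p' [q' pq']]; exists (p * q' + p' * q), (q * q') => x Tx.
have [q0 pE] := pq _ Tx; have [q0' pE'] := pq' _ Tx.
by rewrite !(mevalM, mevalD) mulf_neq0 // -pE -pE'; split=> //; ring.
Qed.

Lemma rationalM h h' : rational_on h -> rational_on h' -> rational_on (fun x => h x * h' x).
Proof.
move=> [p [q pq]] [p' [q' pq']]; exists (p * p'), (q * q') => x Tx.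
rewrite !mevalM; have [q0 <-] := pq _ Tx; have [q0' <-] := pq' _ Tx.
by rewrite mulf_neq0 //; split=> //; ring.
Qed.

Lemma rationalV h : (forall x, T x -> h x != 0) -> rational_on h ->
  rational_on (fun x => (h x)^-1).
Proof.
move=> h0 [p [q pq]]; exists q, p => x Tx; have [q0 <-] := pq _ Tx.
by rewrite mulf_neq0 ?h0 // mulrA mulVf ?h0 // mul1r.
Qed.

Lemma rational_sum (I : Type) (s : seq I) (P : pred I) (F : I -> X -> R) :
  (forall i, P i -> rational_on (F i)) -> rational_on (fun x => \sum_(i <- s | P i) F i x).
Proof.
move=> Fr; elim: s => [|i s IH].
  by apply: rational_ext (rational_cst 0) => x _; rewrite big_nil.
case Pi: (P i); last by apply: rational_ext IH => x _; rewrite big_cons Pi.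
by apply: rational_ext (rationalD (Fr i Pi) IH) => x _; rewrite big_cons Pi.
Qed.

Lemma rational_prod (I : Type) (s : seq I) (P : pred I) (F : I -> X -> R) :
  (forall i, P i -> rational_on (F i)) -> rational_on (fun x => \prod_(i <- s | P i) F i x).
Proof.
move=> Fr; elim: s => [|i s IH].
  by apply: rational_ext (rational_cst 1) => x _; rewrite big_nil.
case Pi: (P i); last by apply: rational_ext IH => x _; rewrite big_cons Pi.
by apply: rational_ext (rationalM (Fr i Pi) IH) => x _; rewrite big_cons Pi.
Qed.

Lemma rational_exp h k : rational_on h -> rational_on (fun x => h x ^+ k).
Proof.
move=> hr; elim: k => [|k IH]; first by apply: rational_ext (rational_cst 1).
by apply: rational_ext (rationalM hr IH) => x _; rewrite exprS.
Qed.

Lemma rational_det n (B : X -> 'M[R]_n) :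
  (forall i j, rational_on (fun x => B x i j)) -> rational_on (fun x => \det (B x)).
Proof.
move=> Br; apply: rational_sum => s _; apply: rationalM; first exact: rational_cst.
exact: rational_prod.
Qed.

Lemma rational_inv n (B : X -> 'M[R]_n) :
  (forall i j, rational_on (fun x => B x i j)) -> (forall x, T x -> B x \in unitmx) ->
  forall i j, rational_on (fun x => invmx (B x) i j).
Proof.
move=> Br Bu i j.
apply: (@rational_ext (fun x => (\det (B x))^-1 * \adj (B x) i j)).
  by move=> x Tx; rewrite /invmx Bu // !mxE.
apply: rationalM; first apply: rationalV (rational_det Br).
  by move=> x Tx; rewrite -unitfE -unitmxE Bu.
apply: (@rational_ext (fun x => (-1) ^+ (j + i) * \det (row' j (col' i (B x))))).
  by move=> x Tx; rewrite mxE.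
apply: rationalM; first exact: rational_cst.
apply: rational_det => k l.
by apply: rational_ext (Br (lift j k) (lift i l)) => x _; rewrite !mxE.
Qed.

Lemma rational_meval N (p : {mpoly R[N]}) (h : X -> 'I_N -> R) :
  (forall i, rational_on (fun x => h x i)) -> rational_on (fun x => p.@[h x]).
Proof.
move=> hr; apply: (@rational_ext
   (fun x => \sum_(m <- msupp p) p@_m * \prod_i h x i ^+ m i)).
  by move=> x _; rewrite mevalE.
apply: rational_sum => m _; apply: rationalM; first exact: rational_cst.
by apply: rational_prod => i _; exact: rational_exp.
Qed.

Definition deg_le d (p : {mpoly R[r]}) := (msize p <= d.+1)%N.

Lemma deg_leM d e p q : deg_le d p -> deg_le e q -> deg_le (d + e) (p * q).
Proof.
rewrite /deg_le => pd qe; have [->|p0] := eqVneq p 0; first by rewrite mul0r msize0.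
have [->|q0] := eqVneq q 0; first by rewrite mulr0 msize0.
by rewrite msizeM // -subn1 leq_subLR add1n (leq_trans (leq_add pd qe)) // addSn addnS.
Qed.

Lemma deg_leX d p k : deg_le d p -> deg_le (k * d) (p ^+ k).
Proof.
move=> pd; elim: k => [|k IH]; first by rewrite /deg_le expr0 msize1.
by rewrite exprS mulSn deg_leM.
Qed.

Lemma deg_le_prod n d (k : 'I_n -> nat) (p : 'I_n -> {mpoly R[r]}) :
  (forall i, deg_le d (p i)) -> deg_le (\sum_i k i * d) (\prod_i p i ^+ k i).
Proof.
move=> pd; elim/big_rec2: _ => [|i e q _ qe]; first by rewrite /deg_le msize1.
by apply: deg_leM => //; exact: deg_leX.
Qed.

(** [M ^ n.+1] counts the products of powers with exponents below [M], and the
    left-hand side bounds the number of monomials in [n] variables that occur in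
    them: it grows like [M ^ n] only. *)
Lemma counting_bound n B : exists2 M, (0 < M)%N &
  ((n.+1 * M * B).+1 ^ n < M ^ n.+1)%N.
Proof.
exists ((n.+1 * B).+1 ^ n).+1 => //; set M := ((n.+1 * B).+1 ^ n).+1.
have le1 : ((n.+1 * M * B).+1 <= (n.+1 * B).+1 * M)%N.
  by rewrite [X in (_ <= X)%N]mulSn mulnAC -add1n leq_add.
apply: (@leq_ltn_trans (((n.+1 * B).+1 * M) ^ n)).
  by have [n0|n0] := posnP n; [rewrite n0|rewrite leq_exp2r].
by rewrite expnMn expnS ltn_pmul2r // expn_gt0.
Qed.

(** Over a common denominator [q], the products of powers of the [r.+1]
    functions with exponents below [M] become, after multiplication by a power
    of [q], polynomials of degree at most [D] in [r] variables.  They are more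
    numerous than the monomials available, so they are linearly dependent. *)
Lemma rational_dependent (fs : seq (X -> R)) : size fs = r.+1 ->
  (forall i : 'I_r.+1, rational_on (nth (fun=> 0) fs i)) ->
  exists2 s : relation R, relation_wf r.+1 s &
    forall x, T x -> \sum_(t <- s) t.2 * monom [seq h x | h <- fs] t.1 = 0.
Proof.
set n := r.+1 => szfs fr.
have [p0 /choice[q0 pq0]] := choice fr.
pose q : {mpoly R[r]} := \prod_i q0 i.
pose p (i : 'I_n) : {mpoly R[r]} := p0 i * \prod_(j | j != i) q0 j.
have pqE (x : X) (i : 'I_n) : T x -> nth (fun=> 0) fs i x * q.@[g x] = (p i).@[g x].
  move=> Tx; have [_ E] := pq0 i x Tx.
  by rewrite /q /p (bigD1 i) //= !mevalM mulrA E.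
have qn0 x : T x -> q.@[g x] != 0.
  move=> Tx; rewrite /q rmorph_prod; apply/prodf_neq0 => i _.
  by have [] := pq0 i x Tx.
pose B := (msize q + \sum_i msize (p i))%N.
have qB : deg_le B q by rewrite /deg_le /B ltnW // ltnS leq_addr.
have pB i : deg_le B (p i).
  by rewrite /deg_le /B ltnW // ltnS (bigD1 i) //= addnCA leq_addr.
have [M M0 cnt] := counting_bound r B.
pose D := (n * M * B)%N.
pose E := {ffun 'I_n -> 'I_M}; pose W := {ffun 'I_r -> 'I_D.+1}.
(* The sum of the exponents is at most n * M, so this is a numerator of the
   product of powers over the denominator q ^+ (n * M). *)
pose G (e : E) : {mpoly R[r]} := (\prod_i p i ^+ e i) * q ^+ (n * M - \sum_i e i).
have eM (e : E) : (\sum_i e i <= n * M)%N.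
  rewrite -[X in (_ <= X * _)%N](card_ord n) -sum_nat_const leq_sum // => i _.
  exact: ltnW.
have GD e : deg_le D (G e).
  have -> : D = (\sum_i e i * B + (n * M - \sum_i e i) * B)%N.
    by rewrite -big_distrl -mulnDl subnKC.
  by apply: deg_leM; [exact: deg_le_prod|exact: deg_leX].
pose mn (w : W) : 'X_{1..r} := [multinom (w i : nat) | i < r].
pose Mat : 'M[R]_(#|E|, #|W|) := \matrix_(i, j) (G (enum_val i))@_(mn (enum_val j)).
have /rowV0Pn[u /sub_kermxP uM u0] : kermx Mat != 0.
  rewrite kermx_eq0 -row_leq_rank -ltnNge (leq_ltn_trans (rank_leq_col _)) //.
  by rewrite !card_ffun !card_ord.
pose c (e : E) : R := u ord0 (enum_rank e).
have G0 : \sum_e c e *: G e = 0.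
  apply/mpolyP => m; rewrite mcoeff0 raddf_sum /=.
  have [mD|/forallPn[j mD]] := boolP [forall j, (m j < D.+1)%N].
    pose w : W := [ffun j => Ordinal (forallP mD j)].
    have -> : m = mn w by apply/mnmP => j; rewrite mnmE ffunE.
    have := congr1 (fun A : 'rV[R]_#|W| => A ord0 (enum_rank w)) uM; rewrite !mxE => uM0.
    rewrite -[RHS]uM0.
    rewrite [RHS](reindex (@enum_rank E)) /=; last exact/onW_bij/enum_rank_bij.
    by apply: eq_bigr => e _; rewrite mcoeffZ !mxE !enum_rankK.
  apply: big1 => e _; rewrite mcoeffZ memN_msupp_eq0 ?mulr0 //.
  apply: msize_mdeg_ge; rewrite (leq_trans (GD e)) //.
  rewrite -leqNgt in mD; apply: leq_trans mD _.
  by rewrite mdegE (bigD1 j) //= leq_addr.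
pose ex (e : E) : seq nat := [seq (e i : nat) | i <- enum 'I_n].
exists [seq (ex e, c e) | e <- enum E & c e != 0].
  apply/and4P; split.
  - have /matrix0Pn[i [j]] := u0; rewrite ord1 => uj.
    have : (ex (enum_val j), c (enum_val j)) \in [seq (ex e, c e) | e <- enum E & c e != 0].
      by apply: map_f; rewrite mem_filter mem_enum /c enum_valK uj.
    by case: [seq _ | _ <- _].
  - rewrite -map_comp map_inj_uniq => [|e e' /= ee']; first exact: (filter_uniq _ (enum_uniq (pred_of_argType E))).
    apply/ffunP => i; apply: val_inj => /=.
    have := congr1 (fun s => nth 0%N s i) ee'.
    by rewrite !(nth_map i) -?enumT ?size_enum_ord // !nth_ord_enum.
  - by apply/allP => _ /mapP[e _ ->] /=; rewrite size_map size_enum_ord.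
  - by apply/allP => _ /mapP[e + ->] /=; rewrite mem_filter => /andP[].
move=> x Tx; rewrite big_map big_filter big_enum_cond /=.
have := congr1 (meval (g x)) G0; rewrite meval0 raddf_sum /=.
have qE : q.@[g x] ^+ (n * M) != 0 by rewrite expf_neq0 ?qn0.
move=> Gx; apply: (mulIf qE); rewrite mul0r -[RHS]Gx mulr_suml.
rewrite [RHS](bigID (fun e => c e != 0)) /= [X in _ = _ + X]big1 ?addr0; last first.
  by move=> e; rewrite negbK mevalZ => /eqP->; rewrite mul0r.
apply: eq_bigr => e _; rewrite mevalZ -mulrA; congr (_ * _).
rewrite (@monomE R _ n) ?size_map -?enumT ?size_enum_ord // /G rmorphM /=.
rewrite (rmorphXn (meval (g x))) -[in LHS](subnKC (eM e)) exprD mulrA; congr (_ * _).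
rewrite -prodrXr -big_split [RHS]rmorph_prod /=; apply: eq_bigr => i _.
rewrite rmorphXn /= -pqE // exprMn (nth_map (fun=> 0)) ?szfs //.
by rewrite (nth_map i) ?size_enum_ord // nth_ord_enum.
Qed.

End Rational.

(** * The lemma of Farkas *)

Section Dot.
Variables (R : realType) (d : nat).
Implicit Types (c x y : 'cV[R]_d).

Lemma dotvE c x : dotv c x = \sum_k c k ord0 * x k ord0.
Proof. by rewrite /dotv mxE; apply: eq_bigr => k _; rewrite mxE. Qed.

Lemma dotvC c x : dotv c x = dotv x c.
Proof. by rewrite !dotvE; apply: eq_bigr => k _; rewrite mulrC. Qed.

Lemma dotvDr c x y : dotv c (x + y) = dotv c x + dotv c y.
Proof. by rewrite /dotv mulmxDr mxE. Qed.

Lemma dotvZr c t x : dotv c (t *: x) = t * dotv c x.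
Proof. by rewrite /dotv -scalemxAr mxE. Qed.

Lemma dotvBr c x y : dotv c (x - y) = dotv c x - dotv c y.
Proof. by rewrite /dotv mulmxBr !mxE. Qed.

Lemma dotv0r c : dotv c 0 = 0.
Proof. by rewrite /dotv mulmx0 mxE. Qed.

Lemma dotv_sumr c (I : Type) (s : seq I) (P : pred I) (F : I -> 'cV[R]_d) :
  dotv c (\sum_(i <- s | P i) F i) = \sum_(i <- s | P i) dotv c (F i).
Proof. by rewrite /dotv mulmx_sumr summxE. Qed.

Lemma dotvDl c x y : dotv (c + y) x = dotv c x + dotv y x.
Proof. by rewrite ![dotv _ x]dotvC dotvDr. Qed.

Lemma dotvBl c x y : dotv (c - y) x = dotv c x - dotv y x.
Proof. by rewrite ![dotv _ x]dotvC dotvBr. Qed.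

Lemma dotvZl c t x : dotv (t *: c) x = t * dotv c x.
Proof. by rewrite ![dotv _ x]dotvC dotvZr. Qed.

Lemma dotvNl c x : dotv (- c) x = - dotv c x.
Proof. by rewrite -scaleN1r dotvZl mulN1r. Qed.

Lemma dotv_suml x (I : Type) (s : seq I) (P : pred I) (F : I -> 'cV[R]_d) :
  dotv (\sum_(i <- s | P i) F i) x = \sum_(i <- s | P i) dotv (F i) x.
Proof. by rewrite dotvC dotv_sumr; apply: eq_bigr => i _; rewrite dotvC. Qed.

Lemma dotv_col m (A : 'M[R]_(d, m)) j x : (A^T *m x) j ord0 = dotv (col j A) x.
Proof. by rewrite dotvE mxE; apply: eq_bigr => k _; rewrite !mxE. Qed.

Lemma dotv_self_eq0 c : dotv c c = 0 -> c = 0.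
Proof.
move=> cc; apply/matrixP => k l; rewrite ord1 mxE.
move/eqP: cc; rewrite dotvE psumr_eq0 => [/allP/(_ k)|i _]; last by rewrite -expr2 sqr_ge0.
by rewrite mem_index_enum => /(_ isT); rewrite mulf_eq0 orbb => /eqP.
Qed.

(** Induction on the number of generators.  If the generators but the first do
    not suffice, some [x0] has nonpositive products with them and a positive one
    with [b], hence a positive one with the first generator.  The projection
    [pr] along the first generator onto the orthogonal complement of [x0]
    preserves the hypothesis, and a representation of [pr b] lifts to one of [b]
    whose first coefficient is nonnegative by the signs at [x0]. *)
Lemma farkas n (g : 'I_n -> 'cV[R]_d) (b : 'cV[R]_d) :
  (forall x, (forall i, dotv (g i) x <= 0) -> dotv b x <= 0) ->
  exists2 w : 'I_n -> R, (forall i, 0 <= w i) & b = \sum_i w i *: g i.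
Proof.
elim: n g b => [|n IH] g b gb.
  exists (fun=> 0) => [[]//|]; rewrite big_ord0; apply: dotv_self_eq0.
  apply/eqP; rewrite eq_le gb; last by case.
  have : dotv b (- b) <= 0 by apply: gb; case.
  by rewrite -scaleN1r dotvZr mulN1r oppr_le0.
have [[x0 [gx0 bx0]]|no] := pselect (exists x, (forall i, dotv (g (lift ord0 i)) x <= 0)
    /\ 0 < dotv b x); last first.
  have [|w w0 ->] := IH (fun i => g (lift ord0 i)) b.
    by move=> x gx; rewrite leNgt; apply/negP => bx; apply: no; exists x.
  exists (fun i => if unlift ord0 i is Some j then w j else 0) => [i|].
    by case: unliftP.
  rewrite big_ord_recl unlift_none scale0r add0r.
  by apply: eq_bigr => i _; rewrite liftK.
have t0 : 0 < dotv (g ord0) x0.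
  rewrite ltNge; apply/negP => g0; have := gb x0; rewrite leNgt bx0 /= => h.
  apply: notF; apply: h => i.
  by case: (unliftP ord0 i) => [j ->|->].
set t := dotv (g ord0) x0 in t0.
pose pr (u : 'cV[R]_d) := u - (dotv u x0 / t) *: g ord0.
have prE u x : dotv (pr u) x = dotv u (x - (dotv (g ord0) x / t) *: x0).
  by rewrite /pr dotvBl dotvZl dotvBr dotvZr -!mulrA; congr (_ - _); ring.
have [|w w0 bw] := IH (fun i => pr (g (lift ord0 i))) (pr b).
  move=> x gx; rewrite prE; apply: gb => i.
  case: (unliftP ord0 i) => [j ->|->]; first by rewrite -prE.
  by rewrite dotvBr dotvZr -/t divfK ?gt_eqF // subrr.
exists (fun i => if unlift ord0 i is Some j then w j else
   dotv b x0 / t - \sum_j w j * (dotv (g (lift ord0 j)) x0 / t)) => [i|].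
  case: (unliftP ord0 i) => [j //|_].
  rewrite subr_ge0; apply: (@le_trans _ _ 0); last by rewrite divr_ge0 // ltW.
  apply: sumr_le0 => j _; rewrite mulr_ge0_le0 // pmulr_lle0 ?invr_gt0 //.
rewrite big_ord_recl unlift_none.
rewrite (eq_bigr (fun i => w i *: g (lift ord0 i))); last by move=> i _; rewrite liftK.
have /eqP := bw; rewrite [pr b]/pr subr_eq => /eqP bE.
rewrite {1}bE scalerBl scaler_suml.
rewrite (eq_bigr (fun i => w i *: g (lift ord0 i) -
   (w i * (dotv (g (lift ord0 i)) x0 / t)) *: g ord0)); last first.
  by move=> i _; rewrite /pr scalerBr scalerA.
by rewrite sumrB -addrA addrC [- _ + _]addrC.
Qed.

End Dot.

(** * Affine independence *)

Section AffineDimension.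
Variables (R : realType) (d : nat).
Implicit Types (S : set 'cV[R]_d).

Lemma aff_indep_inj k l (p : 'I_k -> 'cV[R]_d) (f : 'I_l -> 'I_k) :
  injective f -> aff_indep p -> aff_indep (p \o f).
Proof.
move=> finj ind w w0 wp i.
pose w' t := \sum_(s | f s == t) w s.
have w'E s : w' (f s) = w s.
  rewrite /w' (bigD1 s) //= big1 ?addr0 // => s' /andP[/eqP/finj->].
  by rewrite eqxx.
rewrite -w'E; apply: ind.
  by rewrite -[RHS]w0 [RHS](partition_big f xpredT).
rewrite -[RHS]wp [RHS](partition_big f xpredT) //=; apply: eq_bigr => t _.
by rewrite scaler_suml; apply: eq_bigr => s /eqP <-.
Qed.

Lemma aff_dim_uniq S k l : aff_dim S k -> aff_dim S l -> k = l.
Proof.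
have le_dim k' l' : aff_dim S k' -> aff_dim S l' -> (l' <= k')%N.
  move=> [_ kmax] [[p [Sp ind]] _]; rewrite leqNgt; apply/negP => kl.
  have kl2 : (k'.+2 <= l'.+1)%N by [].
  apply: (kmax (p \o widen_ord kl2)) => [i|]; first exact: Sp.
  apply: aff_indep_inj ind => i j /(congr1 val) ij; exact/val_inj.
by move=> Sk Sl; apply/eqP; rewrite eqn_leq !le_dim.
Qed.

Lemma lin_dependent k (p : 'I_k -> 'cV[R]_d) : (d < k)%N ->
  exists2 w : 'I_k -> R, \sum_i w i *: p i = 0 & exists i, w i != 0.
Proof.
move=> dk; pose B : 'M[R]_(k, d) := \matrix_(i, j) p i j ord0.
have /rowV0Pn[u /sub_kermxP uB /matrix0Pn[i0 [i ui]]] : kermx B != 0.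
  by rewrite kermx_eq0 -row_leq_rank -ltnNge (leq_ltn_trans (rank_leq_col _)).
exists (u ord0); last by exists i; rewrite ord1 in ui.
apply/colP => j; rewrite summxE !mxE.
have := congr1 (fun M : 'rV[R]_d => M ord0 j) uB; rewrite !mxE => E; rewrite -[RHS]E.
by apply: eq_bigr => s _; rewrite !mxE.
Qed.

Lemma lin_indep_dual (p : 'I_d -> 'cV[R]_d) c :
  (forall w, \sum_i w i *: p i = 0 -> forall i, w i = 0) ->
  (forall i, dotv c (p i) = 0) -> c = 0.
Proof.
move=> ind cp; pose B : 'M[R]_d := \matrix_(s, t) p t s ord0.
have BT : row_free B^T.
  apply: inj_row_free => x xB; apply/rowP => t; rewrite mxE.
  apply: (ind (x ord0)); apply/colP => s; rewrite summxE !mxE.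
  have := congr1 (fun M : 'rV[R]_d => M ord0 s) xB; rewrite !mxE => E.
  by rewrite -[RHS]E; apply: eq_bigr => t' _; rewrite !mxE.
have Bu : B \in unitmx by rewrite -unitmx_tr -row_free_unit.
have cB : c^T *m B = 0.
  apply/rowP => t; rewrite mxE [RHS]mxE -[RHS](cp t) dotvE; apply: eq_bigr => s _.
  by rewrite !mxE.
by rewrite -[c]trmxK -[c^T](mulmxK Bu) cB mul0mx trmx0.
Qed.

End AffineDimension.

(** * Polytopes with simple vertex figures *)

(** In a polytope of dimension [d.+1] whose vertex figure at [i] is simple, [k]
    is a vertex of this figure, the [jf l] are the [d] facets through the edge
    from [i] to [k], and [kf l] is the vertex of the figure next to [k] that
    leaves only the facet [jf l]. *)
Definition corner_frame d n m (I : 'I_n -> 'I_m -> bool)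
    (i k : 'I_n) (jf : 'I_d -> 'I_m) (kf : 'I_d -> 'I_n) : Prop :=
  [/\ k != i, forall l, I i (jf l), forall l, I k (jf l)
    & forall l l', I (kf l) (jf l') = (l != l')].

(** The combinatorial input of the metric arguments below, which a finite
    computation verifies for the 24-cell.  In [corner_neighbours] the set [N]
    consists of the vertices of the vertex figure at [i]; it has to contain the
    [kf l] so that a maximum over [N] can be compared with them. *)
Record corner_simple d n m (I : 'I_n -> 'I_m -> bool) : Prop := CornerSimple {
  some_vertex : exists i : 'I_n, true;
  vertex_incomparable : forall i k, (forall j, I i j -> I k j) -> k = i;
  facet_incomparable : forall j k, (forall i, I i j -> I i k) -> k = j;
  no_universal_vertex : forall i, exists j, ~~ I i j;
  corner_neighbours : forall i, exists N : pred 'I_n, (exists k, N k) /\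
    forall k, N k -> exists (jf : 'I_d -> 'I_m) kf,
      corner_frame I i k jf kf /\ forall l, N (kf l);
  facet_in_corner : forall j, exists i k (jf : 'I_d -> 'I_m) kf l,
    corner_frame I i k jf kf /\ jf l = j }.

Section Realization.
Variables (R : realType) (d n m : nat).
Implicit Types (V : 'M[R]_(d.+1, n)) (A : 'M[R]_(d.+1, m)) (I : 'I_n -> 'I_m -> bool).

(** The incidences of [I] hold with equality and the others strictly: the
    conditions on the coordinates of a realization that imply the equality
    [conv V = polyhedron A] for simple vertex figures. *)
Definition incidence_pair I V A := forall i j,
  if I i j then dotv (col j A) (col i V) = 1 else dotv (col j A) (col i V) < 1.

Lemma incidence_le1 I V A i j : incidence_pair I V A -> dotv (col j A) (col i V) <= 1.
Proof. by move/(_ i j); case: (I i j) => [->|/ltW]. Qed.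

Lemma incidence_eq1 I V A i j : incidence_pair I V A ->
  (dotv (col j A) (col i V) == 1) = I i j.
Proof. by move/(_ i j); case: (I i j) => [->|/lt_eqF]; rewrite ?eqxx. Qed.

Lemma incidence_self V A : (forall i j, dotv (col j A) (col i V) <= 1) ->
  incidence_pair (fun i j => dotv (col j A) (col i V) == 1) V A.
Proof. by move=> le1 i j; case: eqP => // /eqP ne1; rewrite lt_neqAle ne1 le1. Qed.

Lemma conv_col V i : conv V (col i V).
Proof.
exists 1%N, (fun=> col i V), (fun=> 1); split; [by exists i|by []| |].
  by rewrite big_ord1.
by rewrite big_ord1 scale1r.
Qed.

Lemma convP V x : conv V x -> exists w : 'I_n -> R,
  [/\ forall i, 0 <= w i, \sum_i w i = 1 & x = \sum_i w i *: col i V].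
Proof.
move=> [k [p [w [pV w0 w1 ->]]]].
have {pV} pV l : exists i, p l = col i V by have [i _ <-] := pV l; exists i.
have {pV} [f pf] := choice pV.
exists (fun i => \sum_(l | f l == i) w l); split.
- by move=> i; apply: sumr_ge0.
- by rewrite -w1 (partition_big f xpredT).
- rewrite (partition_big f xpredT) //=; apply: eq_bigr => i _.
  rewrite scaler_suml; apply: eq_bigr => l /eqP <-.
  by rewrite pf.
Qed.

Lemma conv_comb V (w : 'I_n -> R) : (forall i, 0 <= w i) -> \sum_i w i = 1 ->
  conv V (\sum_i w i *: col i V).
Proof. by move=> w0 w1; exists n, (fun i => col i V), w; split=> // i; exists i. Qed.

(** Farkas for the cone over the polytope placed at height 1. *)
Lemma conv_separated V x : ~ conv V x ->
  exists c, forall i, dotv c (col i V) < dotv c x.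
Proof.
move=> Vx; pose g i : 'cV[R]_(d.+1 + 1) := col_mx (col i V) 1.
have dg c b (y : 'cV[R]_d.+1) (t : 'cV[R]_1) : dotv (col_mx y t) (col_mx c b) =
    dotv c y + b ord0 ord0 * t ord0 ord0.
  rewrite !dotvE big_split_ord /= big_ord1; congr (_ + _).
    by apply: eq_bigr => k _; rewrite !col_mxEu mulrC.
  by rewrite !col_mxEd mulrC.
apply: contrapT => no; apply: Vx.
have [|w w0 xw] := @farkas R _ n g (col_mx x 1).
  move=> z; rewrite -[z]vsubmxK; set c := usubmx z; set b := dsubmx z => cb.
  rewrite dg leNgt; apply/negP => cx; apply: no; exists c => i.
  have := cb i; rewrite dg => /le_lt_trans /(_ cx).
  by rewrite ltrD2r.
have x1 : \sum_i w i = 1.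
  have := congr1 (fun M : 'cV[R]_(d.+1 + 1) => M (rshift d.+1 ord0) ord0) xw.
  rewrite col_mxEd mxE eqxx mulr1n summxE => ->; apply: eq_bigr => i _.
  by rewrite mxE col_mxEd mxE eqxx mulr1.
have -> : x = \sum_i w i *: col i V; last exact: conv_comb.
apply/colP => k.
have := congr1 (fun M : 'cV[R]_(d.+1 + 1) => M (lshift 1 k) ord0) xw.
rewrite col_mxEu !summxE => ->; apply: eq_bigr => i _.
by rewrite mxE col_mxEu !mxE.
Qed.

Section Frames.
Variables (I : 'I_n -> 'I_m -> bool) (V : 'M[R]_(d.+1, n)) (A : 'M[R]_(d.+1, m)).
Hypothesis (Isimple : @corner_simple d n m I) (IVA : incidence_pair I V A).
Local Notation v i := (col i V).
Local Notation a j := (col j A).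

Lemma vertex_inj : injective (fun i => v i).
Proof.
move=> i k vik; apply: (vertex_incomparable Isimple) => j kj.
by rewrite -(incidence_eq1 _ _ IVA) vik (incidence_eq1 _ _ IVA).
Qed.

Lemma facet_normal_inj : injective (fun j => a j).
Proof.
move=> j k ajk; apply: (facet_incomparable Isimple) => i ik.
by rewrite -(incidence_eq1 _ _ IVA) ajk (incidence_eq1 _ _ IVA).
Qed.

Definition frame_point i k (kf : 'I_d -> 'I_n) (t : 'I_d.+2) : 'I_n :=
  if unlift ord0 t is Some t1 then
    if unlift ord0 t1 is Some l then kf l else k
  else i.

(** All points of the frame but [kf l] lie on the facet [jf l], so the product of
    an affine relation with its normal shows that the coefficient of [kf l] is
    0.  What remains is a relation between the distinct points [i] and [k]. *)
Lemma frame_aff_indep i k (jf : 'I_d -> 'I_m) kf : corner_frame I i k jf kf ->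
  aff_indep (fun t => v (frame_point i k kf t)).
Proof.
move=> [ki Ii Ik Ikf] w; rewrite !big_ord_recl /frame_point !unlift_none.
rewrite !liftK !unlift_none.
rewrite (eq_bigr (fun l => w (lift ord0 (lift ord0 l)) *: v (kf l))); last first.
  by move=> l _; rewrite !liftK.
set w0 := w ord0; set w1 := w (lift ord0 ord0).
pose wl l := w (lift ord0 (lift ord0 l)) => sw sv.
have {}sw : w0 + (w1 + \sum_l wl l) = 0 by [].
have {}sv : w0 *: v i + (w1 *: v k + \sum_l wl l *: v (kf l)) = 0 by [].
have wl0 l : wl l = 0.
  have := congr1 (dotv (a (jf l))) sv; rewrite dotv0r !dotvDr !dotvZr dotv_sumr.
  have /eqP -> : dotv (a (jf l)) (v i) == 1 by rewrite (incidence_eq1 _ _ IVA).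
  have /eqP -> : dotv (a (jf l)) (v k) == 1 by rewrite (incidence_eq1 _ _ IVA).
  rewrite !mulr1 (eq_bigr (fun l' => wl l' * dotv (a (jf l)) (v (kf l')))); last first.
    by move=> l' _; rewrite dotvZr.
  set s1 := \sum_l' _ => E; set s2 := \sum_l wl l in sw.
  have s12 : s2 - s1 = 0.
    have -> : s2 - s1 = w0 + (w1 + s2) - (w0 + (w1 + s1)) by ring.
    by rewrite E sw subrr.
  move: s12; rewrite /s2 /s1 -sumrB (bigD1 l) //= big1 ?addr0; last first.
    move=> l' l'l; have /eqP -> : dotv (a (jf l)) (v (kf l')) == 1.
      by rewrite (incidence_eq1 _ _ IVA) Ikf.
    by rewrite mulr1 subrr.
  have := IVA (kf l) (jf l); rewrite Ikf eqxx /= => lt1.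
  rewrite -{1}[wl l]mulr1 -mulrBr => /eqP; rewrite mulf_eq0 subr_eq0 [1 == _]eq_sym (lt_eqF lt1).
  by rewrite orbF => /eqP.
have s0 : \sum_l wl l = 0 by apply: big1 => l _; rewrite wl0.
have sv0 : \sum_l wl l *: v (kf l) = 0 by apply: big1 => l _; rewrite wl0 scale0r.
rewrite s0 addr0 in sw; rewrite sv0 addr0 in sv.
have w10 : w1 = 0.
  apply/eqP; apply: contraTT ki => w1n; rewrite negbK; apply/eqP/vertex_inj.
  have w0E : w0 = - w1 by apply/eqP; rewrite -addr_eq0 sw.
  move: sv; rewrite w0E scaleNr addrC -scalerBr => /eqP.
  by rewrite scaler_eq0 (negPf w1n) subr_eq0 => /eqP.
have w00 : w0 = 0 by rewrite w10 addr0 in sw.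
move=> t; case: (unliftP ord0 t) => [t1 ->|->] //.
by case: (unliftP ord0 t1) => [l ->|->] //; exact: wl0.
Qed.

Lemma frame_dual0 i k (jf : 'I_d -> 'I_m) kf c : corner_frame I i k jf kf ->
  dotv c (v k - v i) = 0 -> (forall l, dotv c (v (kf l) - v i) = 0) -> c = 0.
Proof.
move=> fr ck ckf; have ind := frame_aff_indep fr.
pose r (t : 'I_d.+1) := v (frame_point i k kf (lift ord0 t)) - v i.
apply: (@lin_indep_dual _ _ r) => [x xr t|t]; last first.
  by rewrite /r /frame_point liftK; case: (unliftP ord0 t) => [l _|_].
pose w t := if unlift ord0 t is Some t1 then x t1 else - \sum_t1 x t1.
have /(_ (lift ord0 t)) : forall t, w t = 0; last by rewrite /w liftK.
apply: ind; rewrite big_ord_recl /w unlift_none.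
  by rewrite [X in _ + X](eq_bigr x) ?addNr // => s _; rewrite liftK.
rewrite {1}/frame_point unlift_none scaleNr scaler_suml.
rewrite addrC -sumrB -[RHS]xr; apply: eq_bigr => s _.
by rewrite liftK /r scalerBr.
Qed.

(** It suffices that [c] is a nonnegative combination of the normals of the
    facets at the vertex.  For vertices [k] of the vertex figure, let [h k > 0]
    be the sum of the slacks of these facets; minus the sum of their normals
    takes the value [h k] on the edge towards [k].  Choose [k] with the largest
    ratio of [c] to [h], which is nonpositive, and subtract this multiple of
    that functional.  The result [c'] is nonpositive on the vertex figure and 0
    at [k].  It is determined by its values on the frame at [k], where it agrees
    with a nonnegative combination of the [a (jf l)], because [a (jf l)] is the
    only one of them that is not tight at [kf l].  Undoing the subtraction adds
    a nonnegative multiple of the sum of the normals. *)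
Lemma local_max c i x : (forall k, dotv c (v k) <= dotv c (v i)) ->
  polyhedron A x -> dotv c x <= dotv c (v i).
Proof.
move=> cmax Ax; have [N [[k1 Nk1] Nframe]] := corner_neighbours Isimple i.
pose h k := \sum_(j | I i j) (1 - dotv (a j) (v k)).
have h_gt0 k : N k -> 0 < h k.
  move=> Nk; have [jf [kf [[ki _ _ _] _]]] := Nframe k Nk.
  have [j [Iij Ikj]] : exists j, I i j /\ ~~ I k j.
    apply: contrapT => no; move/eqP: ki; apply.
    apply: (vertex_incomparable Isimple) => j Iij; apply: contrapT => /negP Ikj.
    by apply: no; exists j.
  rewrite /h (bigD1 j) //= ltr_wpDr //.
    by apply: sumr_ge0 => j' _; rewrite subr_ge0 (incidence_le1 _ _ IVA).
  by have := IVA k j; rewrite (negPf Ikj) subr_gt0.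
pose rho k := dotv c (v k - v i) / h k.
have [k Nk kmax] : exists2 k, N k & forall k', N k' -> rho k' <= rho k.
  have [k Nk kmax] := @Order.TotalTheory.arg_maxP _ _ 'I_n k1 N rho Nk1.
  by exists k.
have [jf [kf [fr Nkf]]] := Nframe k Nk; have [ki Ii Ik Ikf] := fr.
have rho0 : rho k <= 0.
  by rewrite /rho pmulr_lle0 ?invr_gt0 ?h_gt0 // dotvBr subr_le0.
pose c' := c + rho k *: \sum_(j | I i j) a j.
have c'E k' : dotv c' (v k' - v i) = dotv c (v k' - v i) - rho k * h k'.
  rewrite /c' dotvDl dotvZl dotv_suml -mulrN; congr (_ + _ * _).
  rewrite /h -sumrN; apply: eq_bigr => j Iij; rewrite dotvBr opprB; congr (_ - _).
  by apply/eqP; rewrite (incidence_eq1 _ _ IVA).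
have c'k : dotv c' (v k - v i) = 0 by rewrite c'E /rho divfK ?subrr ?gt_eqF ?h_gt0.
have c'le k' : N k' -> dotv c' (v k' - v i) <= 0.
  by move=> Nk'; rewrite c'E subr_le0 -ler_pdivrMr ?h_gt0 ?kmax.
have af l l' : dotv (a (jf l)) (v (kf l') - v i) =
    if l' == l then dotv (a (jf l)) (v (kf l)) - 1 else 0.
  rewrite dotvBr; have /eqP -> : dotv (a (jf l)) (v i) == 1.
    by rewrite (incidence_eq1 _ _ IVA).
  case: eqP => [-> //|/eqP ll'].
  have /eqP -> : dotv (a (jf l)) (v (kf l')) == 1 by rewrite (incidence_eq1 _ _ IVA) Ikf.
  by rewrite subrr.
have afl l : dotv (a (jf l)) (v (kf l)) - 1 < 0.
  by have := IVA (kf l) (jf l); rewrite Ikf eqxx subr_lt0.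
pose mu l := dotv c' (v (kf l) - v i) / (dotv (a (jf l)) (v (kf l)) - 1).
have mu0 l : 0 <= mu l by rewrite /mu mulr_le0 ?c'le // invr_le0 ltW.
have c'mu : c' = \sum_l mu l *: a (jf l).
  apply/eqP; rewrite -subr_eq0; apply/eqP/(frame_dual0 fr).
    rewrite dotvBl c'k dotv_suml big1 ?subrr // => l _.
    rewrite dotvZl dotvBr.
    have /eqP -> : dotv (a (jf l)) (v i) == 1 by rewrite (incidence_eq1 _ _ IVA).
    have /eqP -> : dotv (a (jf l)) (v k) == 1 by rewrite (incidence_eq1 _ _ IVA).
    by rewrite subrr mulr0.
  move=> l; rewrite dotvBl dotv_suml (bigD1 l) //= big1 ?addr0; last first.
    by move=> l' l'l; rewrite dotvZl af eq_sym (negPf l'l) mulr0.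
  by rewrite dotvZl af eqxx /mu divfK ?subrr // lt_eqF.
have Aj j : I i j -> dotv (a j) (x - v i) <= 0.
  move=> Iij; rewrite dotvBr subr_le0; have /eqP -> : dotv (a j) (v i) == 1.
    by rewrite (incidence_eq1 _ _ IVA).
  by have := Ax j; rewrite dotv_col.
rewrite -subr_le0 -dotvBr.
have -> : c = c' - rho k *: \sum_(j | I i j) a j by rewrite /c' addrK.
rewrite dotvBl dotvZl -mulNr c'mu !dotv_suml -[X in _ <= X]addr0 lerD //.
  by apply: sumr_le0 => l _; rewrite dotvZl mulr_ge0_le0 // Aj.
by rewrite mulr_ge0_le0 ?oppr_ge0 //; apply: sumr_le0 => j; exact: Aj.
Qed.

(** A point outside the convex hull is separated from it by a functional; the
    functional is maximal at some vertex, and there [local_max] applies. *)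
Lemma conv_eq_polyhedron : conv V = polyhedron A.
Proof.
apply/seteqP; split=> x.
  move=> /convP[w [w0 w1 ->]] j; rewrite dotv_col dotv_sumr -[X in _ <= X]w1.
  apply: ler_sum => i _; rewrite dotvZr -[X in _ <= X]mulr1 ler_wpM2l //.
  exact: incidence_le1 IVA.
move=> Ax; apply: contrapT => /conv_separated[c cx].
have [i0 _] := some_vertex Isimple.
have [i _ imax] := @Order.TotalTheory.arg_maxP _ _ 'I_n i0 xpredT (fun i => dotv c (v i)) isT.
have := local_max (fun k => imax k isT) Ax.
by rewrite leNgt cx.
Qed.

End Frames.
End Realization.

(** * Incidences determine the face lattice *)

Section Faces.
Variables (R : realType) (d n m : nat).
Implicit Types (V : 'M[R]_(d.+1, n)) (A : 'M[R]_(d.+1, m)).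

Definition face_of V A (J : set 'I_m) : set 'cV[R]_d.+1 :=
  [set x | conv V x /\ forall j, J j -> dotv (col j A) x = 1].

Variables (I : 'I_n -> 'I_m -> bool).
Hypothesis Isimple : @corner_simple d n m I.

Section OnePair.
Variables (V : 'M[R]_(d.+1, n)) (A : 'M[R]_(d.+1, m)).
Hypothesis IVA : incidence_pair I V A.
Local Notation v i := (col i V).
Local Notation a j := (col j A).
Local Notation Q := (conv V).
Local Notation face := (face_of V A).
Local Notation facet j := (facet_of_col Q A j).

Lemma conv_le1 x j : Q x -> dotv (a j) x <= 1.
Proof. by rewrite (conv_eq_polyhedron Isimple IVA) => /(_ j); rewrite dotv_col. Qed.

Lemma facet_face j : facet j = face [set j].
Proof.
apply/seteqP; split=> x [Qx]; rewrite ?dotv_col => xj; split=> //.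
  by move=> _ ->.
by rewrite dotv_col xj.
Qed.

Lemma face_of_is_face J : is_face Q (face J).
Proof.
pose c := \sum_(j | `[< J j >]) a j.
exists c, (\sum_(j | `[< J j >]) 1); split=> [x Qx|].
  by rewrite /c dotv_suml; apply: ler_sum => j _; exact: conv_le1.
apply/seteqP; split=> x [Qx xJ]; split=> //.
  by rewrite /c dotv_suml; apply: eq_bigr => j /asboolP; exact: xJ.
move=> j Jj; apply/eqP; rewrite eq_sym -subr_eq0.
have /eqP : \sum_(j | `[< J j >]) (1 - dotv (a j) x) = 0.
  by rewrite sumrB -dotv_suml xJ subrr.
rewrite psumr_eq0 => [/allP/(_ j)|j' _]; last by rewrite subr_ge0 conv_le1.
rewrite mem_index_enum => /(_ isT) /implyP; apply; exact/asboolP.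
Qed.

Lemma face_vertex J i : face J (v i) <-> forall j, J j -> I i j.
Proof.
split=> [[_ vJ] j /vJ/eqP|Jj]; first by rewrite (incidence_eq1 _ _ IVA).
split; first exact: conv_col.
by move=> j /Jj Iij; apply/eqP; rewrite (incidence_eq1 _ _ IVA).
Qed.

Lemma face_comb J x : face J x -> exists w : 'I_n -> R,
  [/\ forall i, 0 <= w i, \sum_i w i = 1, x = \sum_i w i *: v i
    & forall i, w i != 0 -> face J (v i)].
Proof.
move=> [/convP[w [w0 w1 xE]] xJ]; exists w; split=> // i wi.
apply/face_vertex => j Jj; rewrite -(incidence_eq1 _ _ IVA).
have /eqP : \sum_i w i * (1 - dotv (a j) (v i)) = 0.
  transitivity (\sum_i w i - dotv (a j) x).
    rewrite xE dotv_sumr -sumrB; apply: eq_bigr => k _.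
    by rewrite dotvZr mulrBr mulr1.
  by rewrite w1 xJ // subrr.
rewrite psumr_eq0 => [/allP/(_ i)|k _]; last first.
  by rewrite mulr_ge0 // subr_ge0 (incidence_le1 _ _ IVA).
rewrite mem_index_enum => /(_ isT); rewrite mulf_eq0 (negPf wi) subr_eq0 /=.
by rewrite eq_sym.
Qed.

Lemma face_has_vertex J x : face J x -> exists i, face J (v i).
Proof.
move=> /face_comb[w [w0 w1 _ wJ]]; apply: contrapT => no.
have /eqP := w1; rewrite big1 => [|i _]; first by rewrite eq_sym oner_eq0.
by apply/eqP; apply: contrapT => /negP wi; apply: no; exists i; exact: wJ.
Qed.

Lemma sub_faces J K : face J `<=` face K <->
  forall i, (forall j, J j -> I i j) -> forall j, K j -> I i j.
Proof.
split=> [JK i /face_vertex/JK/face_vertex //|JK x Jx].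
have [w [w0 w1 xE wJ]] := face_comb Jx; split; first by case: Jx.
move=> j Kj; rewrite xE dotv_sumr -w1; apply: eq_bigr => i _; rewrite dotvZr.
have [->|wi] := eqVneq (w i) 0; first by rewrite mul0r.
have /face_vertex/JK/(_ j Kj) := wJ i wi.
by rewrite -(incidence_eq1 _ _ IVA) => /eqP->; rewrite mulr1.
Qed.

Lemma vertex_face i : [set v i] = face [set j | I i j].
Proof.
apply/seteqP; split=> x; first by move=> ->; apply/face_vertex.
move=> /face_comb[w [w0 w1 -> wi]].
have wk k : k != i -> w k = 0.
  move=> ki; apply/eqP; apply: contraNT ki => /wi/face_vertex ik.
  by apply/eqP/(vertex_incomparable Isimple).
rewrite /= (bigD1 i) //= big1 ?addr0 => [|k ki]; last by rewrite wk ?scale0r.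
have -> : w i = 1 by rewrite -w1 (bigD1 i) //= big1 ?addr0 // => k; exact: wk.
by rewrite scale1r.
Qed.

Lemma face_all : face setT = set0.
Proof.
apply/seteqP; split=> x // /face_has_vertex[i /face_vertex iT].
by have [j] := no_universal_vertex Isimple i; rewrite iT.
Qed.

(** For each facet that does not contain [G] choose a point of [G] off it.  The
    average [z] of these points and of [g0] lies on no facet but those that
    contain [G].  So for [x] in the right-hand side the segment from [x] to [z]
    can be prolonged beyond [z] within the polytope, and the functional that
    defines [G], which is maximal at [z], is constant on it. *)
Lemma is_face_facets G : is_face Q G -> G = face [set j | G `<=` facet j].
Proof.
move=> [c [b [cb GE]]].
have [[g0 Gg0]|noG] := pselect (exists g, G g); last first.
  have G0 : G = set0 by apply/seteqP; split=> x // Gx; apply: noG; exists x.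
  rewrite [LHS]G0 -face_all; congr face_of.
  by apply/seteqP; split=> // j _ x; rewrite G0.
have gP j : exists g, G g /\ (~ G `<=` facet j -> dotv (a j) g < 1).
  have [sub|nsub] := pselect (G `<=` facet j); first by exists g0; split.
  have [g [Gg gj]] : exists g, G g /\ ~ facet j g.
    apply: contrapT => no; apply: nsub => x Gx; apply: contrapT => xj.
    by apply: no; exists x.
  exists g; split=> // _; have Qg : Q g by move: Gg; rewrite GE => -[].
  rewrite lt_neqAle conv_le1 // andbT; apply/eqP => gj1; apply: gj.
  by split=> //; rewrite dotv_col.
have [g {}gP] := choice gP.
pose z : 'cV[R]_d.+1 := (m.+1%:R)^-1 *: (g0 + \sum_j g j).
have m0 : 0 < m.+1%:R :> R by rewrite ltr0n.
have avg u t : dotv u g0 <= t -> (forall j, dotv u (g j) <= t) -> dotv u z <= t.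
  move=> u0 uj; rewrite /z dotvZr mulrC ler_pdivrMr // dotvDr dotv_sumr.
  have -> : t * m.+1%:R = t + \sum_(j < m) t.
    by rewrite sumr_const card_ord mulr_natr mulrS.
  by rewrite lerD // ler_sum.
have Gle u t : (forall x, G x -> dotv u x <= t) -> dotv u z <= t.
  by move=> h; apply: avg; [exact: h|move=> j; apply: h; case: (gP j)].
have Geq u t : (forall x, G x -> dotv u x = t) -> dotv u z = t.
  move=> h; apply/eqP; rewrite eq_le Gle => [|x /h->//] /=.
  by rewrite -lerN2 -dotvNl Gle // => x Gx; rewrite dotvNl h.
apply/seteqP; split=> x.
  move=> Gx; split; first by move: Gx; rewrite GE => -[].
  by move=> j /(_ x Gx) [_]; rewrite dotv_col.
move=> [Qx xJ].
have zlt j : ~ G `<=` facet j -> dotv (a j) z < 1.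
  move=> nj; rewrite /z dotvZr mulrC ltr_pdivrMr // mul1r dotvDr dotv_sumr.
  rewrite (bigD1 j) //= addrA.
  have -> : m.+1%:R = 1 + 1 + \sum_(k < m | k != j) 1 :> R.
    rewrite -addrA -(bigD1 (P := xpredT) j) //= sumr_const card_ord.
    by rewrite mulrSr addrC.
  rewrite ltr_leD //; last first.
    apply: ler_sum => k _; apply: conv_le1; have [+ _] := gP k.
    by rewrite GE => -[].
  rewrite ler_ltD //; last by have [_] := gP j; apply.
  by apply: conv_le1; move: Gg0; rewrite GE => -[].
(* The facet j allows the prolongation by every e' up to e. *)
have ePj j : exists e : R, 0 < e /\ forall e', 0 < e' -> e' <= e ->
    dotv (a j) (z + e' *: (z - x)) <= 1.
  have [sub|nsub] := pselect (G `<=` facet j).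
    exists 1; split=> // e' _ _; rewrite dotvDr [dotv _ (e' *: _)]dotvZr dotvBr xJ //.
    rewrite (@Geq (a j) 1) ?subrr ?mulr0 ?addr0 // => y /sub[_].
    by rewrite dotv_col.
  have lt1 := zlt j nsub; set t := dotv (a j) z in lt1.
  pose s := `|t - dotv (a j) x| + 1.
  have s0 : 0 < s by rewrite ltr_wpDl.
  exists ((1 - t) / s); split; first by rewrite divr_gt0 ?subr_gt0.
  move=> e' e'0; rewrite ler_pdivlMr // => e's.
  rewrite dotvDr [dotv _ (e' *: _)]dotvZr dotvBr -/t addrC -lerBrDr (le_trans _ e's) //.
  rewrite ler_wpM2l ?ltW // (le_lt_trans (ler_norm _)) // /s ltrDl ltr01 //.
have [e {}ePj] := choice ePj.
pose e0 := \big[Num.min/1]_j e j.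
have e00 : 0 < e0 by apply: (big_ind (fun y => 0 < y)) => // [y1 y2 h1 h2|j _]; [rewrite lt_min h1|case: (ePj j)].
have e0le j : e0 <= e j by exact: bigmin_le.
have Qz : Q (z + e0 *: (z - x)).
  rewrite (conv_eq_polyhedron Isimple IVA) => j; rewrite dotv_col.
  by have [_] := ePj j; apply.
rewrite GE; split=> //.
have cz : dotv c z = b by apply: Geq => y; rewrite GE => -[].
apply/eqP; rewrite eq_le cb //=.
have := cb _ Qz; rewrite dotvDr [dotv _ (e0 *: _)]dotvZr dotvBr cz gerDl.
by rewrite pmulr_rle0 // subr_le0.
Qed.

Lemma simple_aff_dim : aff_dim Q d.+1.
Proof.
split; last first.
  move=> p Qp ind; pose q t : 'cV[R]_(d.+1 + 1) := col_mx (p t) 1.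
  have [|w wq [t wt]] := @lin_dependent R _ _ q; first by rewrite addn1.
  move/eqP: wt; apply; apply: ind.
    have := congr1 (fun M : 'cV[R]_(d.+1 + 1) => M (rshift d.+1 ord0) ord0) wq.
    rewrite summxE [RHS]mxE => E; rewrite -[RHS]E; apply: eq_bigr => s _.
    by rewrite mxE col_mxEd mxE eqxx mulr1.
  apply/colP => k.
  have := congr1 (fun M : 'cV[R]_(d.+1 + 1) => M (lshift 1 k) ord0) wq.
  rewrite !summxE [RHS]mxE mxE => E; rewrite -[RHS]E; apply: eq_bigr => s _.
  by rewrite [RHS]mxE mxE col_mxEu.
have [i _] := some_vertex Isimple.
have [N [[k Nk] /(_ k Nk) [jf [kf [fr _]]]]] := corner_neighbours Isimple i.
exists (fun t => v (frame_point i k kf t)); split=> [t|]; first exact: conv_col.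
exact: (frame_aff_indep Isimple IVA fr).
Qed.

(** The frame that has the facet as [jf l] consists of points of the facet, up
    to the one that leaves it.  Conversely, the facet lies in a hyperplane off
    the origin, so affinely independent points of it are linearly
    independent. *)
Lemma facet_aff_dim j : aff_dim (facet j) d.
Proof.
split; last first.
  move=> p Fp ind.
  have [|w wp [t wt]] := @lin_dependent R _ _ p; first by [].
  move/eqP: wt; apply; apply: ind => //.
  have := congr1 (dotv (a j)) wp; rewrite dotv0r dotv_sumr => E; rewrite -[RHS]E.
  apply: eq_bigr => s _; rewrite dotvZr; have [_] := Fp s.
  by rewrite dotv_col => ->; rewrite mulr1.
have [i [k [jf [kf [l [fr jl]]]]]] := facet_in_corner Isimple j.
pose f : 'I_d.+1 -> 'I_d.+2 := lift (lift ord0 (lift ord0 l)).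
exists ((fun t => v (frame_point i k kf t)) \o f); split; last first.
  apply: aff_indep_inj; [exact: lift_inj|exact: (frame_aff_indep Isimple IVA fr)].
move=> t; rewrite facet_face; apply/face_vertex => _ ->.
have [_ Ii Ik Ikf] := fr; rewrite -jl /= /frame_point.
case: (unliftP ord0 (f t)) => [t1 ft|_]; last exact: Ii.
case: (unliftP ord0 t1) => [l' t1E|_]; last exact: Ik.
rewrite Ikf; apply/eqP => l'l; have := neq_lift (lift ord0 (lift ord0 l)) t.
by rewrite -/(f t) ft t1E l'l eqxx.
Qed.

(** The faces are the sets [face J].  A facet [G] lies on some facet [j], being of
    smaller dimension than [Q], and on only one, because its [d.+1] affinely
    independent points determine the normal. *)
Lemma incidence_labeled : labeled_polytope V (facet_of_col Q A).
Proof.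
split.
- exact: simple_aff_dim.
- exact: vertex_inj Isimple IVA.
- move=> x; split=> [xv|[i ->]]; last first.
    by rewrite /is_vertex vertex_face; exact: face_of_is_face.
  have xE := is_face_facets xv.
  have /face_has_vertex[i] : face [set j | [set x] `<=` facet j] x by rewrite -xE.
  by rewrite -xE => vx; exists i.
- move=> j k jk; apply/esym/(facet_incomparable Isimple) => i Iij.
  have : facet j (v i) by rewrite facet_face; apply/face_vertex => _ ->.
  by rewrite jk facet_face => /face_vertex; apply.
- move=> G; split=> [[faceG [k [Gk Qk]]]|[j ->]]; last first.
    split; first by rewrite facet_face; exact: face_of_is_face.
    by exists d; split; [exact: facet_aff_dim|exact: simple_aff_dim].
  have [kd] := aff_dim_uniq Qk simple_aff_dim; subst k.
  have GE := is_face_facets faceG.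
  have [[j Gj]|noj] := pselect (exists j, G `<=` facet j); last first.
    have GQ : G = Q.
      rewrite GE; apply/seteqP; split=> [x []//|x Qx]; split=> // j /= Gj.
      by case: noj; exists j.
    by have /n_Sn := aff_dim_uniq Gk (eq_ind_r (fun S => aff_dim S _) simple_aff_dim GQ).
  exists j; apply/seteqP; split=> // x xj; rewrite GE.
  have [Qx xj1] := xj; split=> // k Gk'.
  suff -> : k = j by rewrite -dotv_col.
  have [[p [Gp ind]] _] := Gk.
  have dp l t : G `<=` facet l -> dotv (a l) (p t) = 1.
    by move=> /(_ _ (Gp t)) [_]; rewrite dotv_col.
  apply: (facet_normal_inj Isimple IVA); apply/eqP; rewrite -subr_eq0; apply/eqP.
  apply: (@lin_indep_dual _ _ p) => [w wp|t]; last by rewrite dotvBl !dp ?subrr.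
  apply: ind => //; have := congr1 (dotv (a j)) wp; rewrite dotv0r dotv_sumr => E.
  by rewrite -[RHS]E; apply: eq_bigr => t _; rewrite dotvZr dp // mulr1.
Qed.

End OnePair.

Section TwoPairs.
Variables (V V' : 'M[R]_(d.+1, n)) (A A' : 'M[R]_(d.+1, m)).
Hypothesis (IVA : incidence_pair I V A) (IVA' : incidence_pair I V' A').

(* By is_face_facets a face is recovered from the facets above it. *)
Let phi (G : set 'cV[R]_d.+1) :=
  face_of V' A' [set j | G `<=` facet_of_col (conv V) A j].

Lemma phi_face J : phi (face_of V A J) = face_of V' A' J.
Proof.
have JE := is_face_facets IVA (face_of_is_face IVA J).
rewrite /phi; set K := [set j | _] in JE *.
by apply/seteqP; split; apply/(sub_faces IVA')/(sub_faces IVA); rewrite -JE.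
Qed.

Lemma incidence_realizes : realizes V' (facet_of_col (conv V') A') V (facet_of_col (conv V) A).
Proof.
split; first exact: incidence_labeled.
exists phi; split.
- split=> [G _|G H Gface Hface|G' G'face]; first exact: face_of_is_face.
    rewrite (is_face_facets IVA Gface) (is_face_facets IVA Hface) !phi_face.
    by rewrite (sub_faces IVA) (sub_faces IVA').
  rewrite (is_face_facets IVA' G'face); set J := [set j | _].
  by exists (face_of V A J); [exact: face_of_is_face|exact: phi_face].
- by move=> i; rewrite (vertex_face IVA) (vertex_face IVA') phi_face.
- by move=> j; rewrite !facet_face phi_face.
Qed.

End TwoPairs.

(** A realization satisfies the inequalities because its vertices are in the
    polyhedron of [A], and the isomorphism, which preserves inclusions of
    vertices in facets, says where they are equalities. *)
Lemma centered_realization_spaceE (V : 'M[R]_(d.+1, n)) (A : 'M[R]_(d.+1, m)) :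
  incidence_pair I V A -> forall M,
  centered_realization_space V (facet_of_col (conv V) A) M <->
  incidence_pair I (lsubmx M) (rsubmx M).
Proof.
move=> IVA M; split=> [[convE [_ [phi [[_ phile _] phiv phif]]]]|IM]; last first.
  by split; [exact: conv_eq_polyhedron Isimple IM|exact: incidence_realizes].
have le1 i j : dotv (col j (rsubmx M)) (col i (lsubmx M)) <= 1.
  have : conv (lsubmx M) (col i (lsubmx M)) by exact: conv_col.
  by rewrite convE => /(_ j); rewrite dotv_col.
suff E i j : (dotv (col j (rsubmx M)) (col i (lsubmx M)) == 1) = I i j.
  by move=> i j; rewrite -E; exact: incidence_self.
have viface : is_face (conv V) [set col i V].
  by rewrite (vertex_face IVA); exact: face_of_is_face.
have fjface : is_face (conv V) (facet_of_col (conv V) A j).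
  by rewrite facet_face; exact: face_of_is_face.
have := phile _ _ viface fjface; rewrite phiv phif => iff.
apply/eqP/idP => [ij|Iij].
  have /iff sub : [set col i (lsubmx M)] `<=` facet_of_col (conv (lsubmx M)) (rsubmx M) j.
    by move=> _ ->; split; [exact: conv_col|rewrite dotv_col].
  have [_] := sub _ erefl; rewrite dotv_col => /eqP.
  by rewrite (incidence_eq1 _ _ IVA).
have /iff sub : [set col i V] `<=` facet_of_col (conv V) A j.
  move=> _ ->; split; first exact: conv_col.
  by rewrite dotv_col; apply/eqP; rewrite (incidence_eq1 _ _ IVA).
by have [_] := sub _ erefl; rewrite dotv_col.
Qed.

End Faces.

(** * Constructing a realization one vector at a time *)

Definition pair_space (R : realType) d n m (I : 'I_n -> 'I_m -> bool) :
    set 'rV[R]_(d.+1 * (n + m)) :=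
  [set x | incidence_pair I (lsubmx (vec_mx x : 'M[R]_(d.+1, n + m))) (rsubmx (vec_mx x))].

Section Elements.
Variables (n m : nat) (I : 'I_n -> 'I_m -> bool).

(** Vertices and facets play the same part in the incidence equations, so a
    construction may list them in any mixed order. *)
Definition element := ('I_n + 'I_m)%type.

Definition incident (x y : element) : bool :=
  match x, y with inl i, inr j | inr j, inl i => I i j | _, _ => false end.

Definition nonincident (x y : element) : bool :=
  match x, y with inl i, inr j | inr j, inl i => ~~ I i j | _, _ => false end.

(** A certificate that the vectors of [ys] are affinely independent at every
    point of the space: [w] is a vector whose product is 1 with all of
    [ys'] and is not 1 with [y], so that [y] is not in the affine span of
    [ys']. *)
Fixpoint peelable (ys : seq element) : Prop :=
  if ys is y :: ys' then
    (ys' = [::] \/ exists w, nonincident w y && all (incident w) ys') /\ peelable ys'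
  else True.

(** Each step names a new vector and the incident earlier vectors that are used
    to determine it. *)
Definition construction := seq (element * seq element).

Fixpoint construction_wf (done : seq element) (s : construction) : Prop :=
  if s is (x, ys) :: s' then
    [/\ x \notin done, all (incident x) ys, peelable ys, {subset ys <= done}
      & construction_wf (x :: done) s']
  else forall x, x \in done.

(** A vector of length [D] with [k] prescribed products needs [D - k] more data,
    which are numbered [k, ..., D.-1]. *)
Definition slots D (s : construction) : seq (element * 'I_D) :=
  flatten [seq [seq (t.1, r) | r <- enum 'I_D & (size t.2 <= (r : 'I_D))%N] | t <- s].

Lemma size_slots D s : size (slots D s) = sumn [seq D - size t.2 | t <- s]%N.
Proof.
rewrite size_flatten /shape -map_comp; congr sumn; apply: eq_map => t /=.
rewrite size_map; set k := size t.2.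
have -> : size [seq r <- enum 'I_D | (k <= (r : 'I_D))%N] = size [seq r <- iota 0 D | (k <= r)%N].
  by rewrite -val_enum_ord filter_map size_map.
rewrite size_filter.
have [kD|Dk] := leqP k D; last first.
  rewrite (eqP (_ : D - k == 0)%N); last by rewrite subn_eq0 ltnW.
  apply/eqP; rewrite -leqn0 leqNgt -has_count; apply/hasPn => r.
  by rewrite mem_iota /= add0n -ltnNge => rD; exact: ltn_trans Dk.
rewrite -{1}(subnKC kD) iotaD count_cat add0n.
rewrite (eq_in_count (a2 := pred0)) ?count_pred0 => [|r]; last first.
  by rewrite mem_iota add0n /= => rk; rewrite leqNgt rk.
rewrite (eq_in_count (a2 := predT)) ?count_predT ?size_iota // => r.
by rewrite mem_iota => /andP[].
Qed.

End Elements.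

Section Charts.
Variables (R : realType) (d n m : nat) (I : 'I_n -> 'I_m -> bool).
Local Notation D := d.+1.
Local Notation point := 'rV[R]_(D * (n + m)).
Local Notation element := (element n m).

Definition vec_of (x : point) (e : element) : 'cV[R]_D :=
  match e with inl i => col i (lsubmx (vec_mx x)) | inr j => col j (rsubmx (vec_mx x)) end.

Lemma vec_of_incident x y z : pair_space I x -> incident I y z -> dotv (vec_of x y) (vec_of x z) = 1.
Proof.
move=> Ix; case: y => [i|j]; case: z => [i'|j'] //= Iij; last first.
  by apply/eqP; rewrite (incidence_eq1 _ _ Ix).
by rewrite dotvC; apply/eqP; rewrite (incidence_eq1 _ _ Ix).
Qed.

Lemma vec_of_nonincident x y z : pair_space I x -> nonincident I y z -> dotv (vec_of x y) (vec_of x z) != 1.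
Proof.
move=> Ix; case: y => [i|j]; case: z => [i'|j'] //= Iij.
  by rewrite dotvC (incidence_eq1 _ _ Ix).
by rewrite (incidence_eq1 _ _ Ix).
Qed.

(** The relation is affine, so its product with the vector [w] that peels off
    the first element leaves only the coefficient of this element. *)
Lemma peelable_indep x y0 ys (l : nat -> R) : pair_space I x -> peelable I ys ->
  \sum_(s < size ys) l s = 0 ->
  \sum_(s < size ys) l s *: vec_of x (nth y0 ys s) = 0 ->
  forall s, (s < size ys)%N -> l s = 0.
Proof.
move=> Ix; elim: ys l => [|y ys IH] l //= [yw ysp]; rewrite !big_ord_recl /= => l0 ly.
have {}l0 : l 0%N + \sum_(s < size ys) l s.+1 = 0 := l0.
have {}ly : l 0%N *: vec_of x y + \sum_(s < size ys) l s.+1 *: vec_of x (nth y0 ys s) = 0 := ly.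
have l00 : l 0%N = 0.
  case: yw => [ys0|[w /andP[wy wys]]].
    by move: l0; rewrite ys0 big_ord0 addr0.
  have := congr1 (dotv (vec_of x w)) ly; rewrite dotv0r dotvDr dotvZr dotv_sumr.
  rewrite (eq_bigr (fun s : 'I_(size ys) => l s.+1)) => [E|s _]; last first.
    by rewrite dotvZr vec_of_incident ?mulr1 //; apply: (allP wys); rewrite mem_nth.
  have : l 0%N * (dotv (vec_of x w) (vec_of x y) - 1) = 0.
    by rewrite -[RHS](subrr 0) -[X in _ = X - _]E -[X in _ = _ - X]l0; ring.
  move/eqP; rewrite mulf_eq0 subr_eq0 (negPf (vec_of_nonincident Ix wy)) orbF.
  by move/eqP.
rewrite l00 add0r in l0; rewrite l00 scale0r add0r in ly.
by case=> // s; rewrite ltnS; exact: (IH (fun s => l s.+1) ysp l0 ly).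
Qed.

(** In a chart [c], if [k] products of the vector [e] are prescribed, its free
    coordinates are those numbered [c e s] for [k <= s]. *)
Definition chart := {ffun element -> {ffun 'I_D -> 'I_D}}.

(** The system that determines the vector [e]: the prescribed products with
    [ys], completed by the free coordinates of the chart. *)
Definition step_mx (c : chart) (x : point) (e : element) (ys : seq element) : 'M[R]_D :=
  \matrix_(s, t) if (s < size ys)%N then vec_of x (nth e ys s) t ord0 else (t == c e s)%:R.

Definition step_rhs (c : chart) (x : point) (e : element) (ys : seq element) : 'cV[R]_D :=
  \col_s if (s < size ys)%N then 1 else vec_of x e (c e s) ord0.

Lemma step_mx_vec_of c x e ys : pair_space I x -> all (incident I e) ys ->
  step_mx c x e ys *m vec_of x e = step_rhs c x e ys.
Proof.
move=> Ix ye; apply/colP => s; rewrite !mxE.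
have [sy|sy] := ltnP s (size ys).
  rewrite -(vec_of_incident Ix (_ : incident I e (nth e ys s))); last by apply: (allP ye); rewrite mem_nth.
  by rewrite dotvC dotvE; apply: eq_bigr => t _; rewrite mxE sy.
rewrite (bigD1 (c e s)) //= big1 ?addr0 => [|t tc]; last first.
  by rewrite mxE ltnNge sy /= (negPf tc) mul0r.
by rewrite mxE ltnNge sy /= eqxx mul1r.
Qed.

(** The rows of the prescribed products are linearly independent: the product
    with the vector [e] shows that a linear relation is affine, and
    [peelable_indep] applies.  So there is an invertible square submatrix, and
    the coordinates off its columns can be taken as the free ones. *)
Lemma unit_step_exists x e ys : pair_space I x -> all (incident I e) ys -> peelable I ys ->
  exists h : {ffun 'I_D -> 'I_D}, forall c : chart, c e = h -> step_mx c x e ys \in unitmx.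
Proof.
move=> Ix ye yp; set k := size ys.
pose Y : 'M[R]_(k, D) := \matrix_(s, t) vec_of x (nth e ys s) t ord0.
have Yfree : row_free Y.
  apply: inj_row_free => u uY; apply/rowP => s; rewrite mxE.
  pose l s := if insub s is Some s' then u ord0 s' else 0.
  have lE (s' : 'I_k) : l s' = u ord0 s' by rewrite /l valK.
  have ly : \sum_(s < k) l s *: vec_of x (nth e ys s) = 0.
    apply/colP => t; rewrite summxE [RHS]mxE.
    have := congr1 (fun M : 'rV[R]_D => M ord0 t) uY; rewrite mxE [RHS]mxE => E.
    by rewrite -[RHS]E; apply: eq_bigr => s' _; rewrite !mxE lE.
  rewrite -lE; apply: (peelable_indep Ix yp _ ly) => //.
  have := congr1 (dotv (vec_of x e)) ly; rewrite dotv0r dotv_sumr => E; rewrite -[RHS]E.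
  apply: eq_bigr => s' _; rewrite dotvZr vec_of_incident ?mulr1 //.
  by apply: (allP ye); rewrite mem_nth.
have Yfull : row_full Y^T by rewrite /row_full mxrank_tr.
pose f := fullrankfun Yfull.
have fu : rowsub f Y^T \in unitmx := fullrowsub_unit Yfull.
pose Im : {set 'I_D} := imset f (mem predT).
pose C := enum (~: Im).
have finj : injective f by exact: fullrankfun_inj.
have szC : (k + size C)%N = D.
  by rewrite /C -cardE; have := cardsC Im; rewrite card_imset // !card_ord.
(* C lists the D - k columns off the invertible minor; the default ord0 is met
   only for s < k. *)
exists [ffun s : 'I_D => nth ord0 C (s - k)] => c ce.
rewrite -unitmx_tr -row_free_unit; apply: inj_row_free => u uB.
have uBs s : \sum_t step_mx c x e ys s t * u ord0 t = 0.
  have := congr1 (fun M : 'rV[R]_D => M ord0 s) uB; rewrite mxE [RHS]mxE => E.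
  rewrite -[RHS]E; apply: eq_bigr => t _; rewrite mulrC; congr (_ * _). by rewrite [RHS]mxE.
have uC t : t \notin Im -> u ord0 t = 0.
  move=> tf; have tC : t \in C by rewrite mem_enum inE.
  have sD : (k + index t C < D)%N by rewrite (leq_trans _ (eq_leq szC)) // ltn_add2l index_mem.
  have := uBs (Ordinal sD); rewrite (bigD1 t) //= big1 ?addr0 => [|t' t't].
    by rewrite mxE /= ltnNge leq_addr /= ce ffunE /= addKn nth_index // eqxx mul1r.
  rewrite mxE /= ltnNge leq_addr /= ce ffunE /= addKn nth_index //.
  by rewrite (negPf t't) mul0r.
have uf : (\row_s u ord0 (f s)) *m rowsub f Y^T = 0.
  apply/rowP => s; rewrite mxE [RHS]mxE.
  have kD : (s < D)%N by rewrite -szC (leq_trans (ltn_ord s)) // leq_addr.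
  rewrite -[RHS](uBs (Ordinal kD)) [RHS](bigID (mem Im)) /=.
  rewrite [X in _ = _ + X]big1 ?addr0 => [|t tf]; last by rewrite uC ?mulr0.
  rewrite big_imset => [|s1 s2 _ _]; last exact: finj.
  apply: eq_bigr => t _.
  by rewrite !mxE /= ltn_ord mulrC.
have uf0 s : u ord0 (f s) = 0.
  have := mulmxK fu (\row_s u ord0 (f s)); rewrite uf mul0mx => /rowP/(_ s).
  by rewrite !mxE.
apply/rowP => t; rewrite [RHS]mxE.
have [/imsetP[s _ ->]|/uC //] := boolP (t \in Im); exact: uf0.
Qed.

Lemma step_mx_chart (c c' : chart) x e ys : c e = c' e -> step_mx c x e ys = step_mx c' x e ys.
Proof. by move=> cc; apply/matrixP => s t; rewrite !mxE cc. Qed.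

Lemma wf_fresh done s t : construction_wf I done s -> t \in s -> t.1 \notin done.
Proof.
elim: s done => [//|[e ys] s IH] done [edone _ _ _ wf]; rewrite inE => /orP[/eqP->//|ts].
by have := IH _ wf ts; rewrite inE negb_or => /andP[].
Qed.

Lemma chart_exists x done s : pair_space I x -> construction_wf I done s ->
  exists c : chart, forall t, t \in s -> step_mx c x t.1 t.2 \in unitmx.
Proof.
move=> Ix; elim: s done => [|[e ys] s IH] done; first by exists [ffun=> [ffun=> ord0]].
move=> [_ ye yp _ wf]; have [c cs] := IH _ wf.
have [h hB] := unit_step_exists Ix ye yp.
exists [ffun e' => if e' == e then h else c e'] => t; rewrite inE => /orP[/eqP->|ts].
  by apply: hB; rewrite ffunE eqxx.
have := wf_fresh wf ts; rewrite inE negb_or => /andP[te _].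
by rewrite (@step_mx_chart _ c) ?cs // ffunE (negPf te).
Qed.

Section Steps.
Variables (steps : construction n m) (c : chart).
Hypothesis steps_wf : construction_wf I [::] steps.
Local Notation r := (size (slots D steps)).

Definition chart_set : set point :=
  [set x | pair_space I x /\ forall t, t \in steps -> step_mx c x t.1 t.2 \in unitmx].

Definition slot_value (x : point) (i : 'I_r) : R :=
  let: (e, s) := tnth (in_tuple (slots D steps)) i in vec_of x e (c e s) ord0.

Local Notation rational := (rational_on chart_set slot_value).

Lemma rational_slot e ys (s : 'I_D) : (e, ys) \in steps -> (size ys <= s)%N ->
  rational (fun x => vec_of x e (c e s) ord0).
Proof.
move=> eys ss.
have es : (e, s) \in slots D steps.
  apply/flatten_mapP; exists (e, ys) => //=.
  by apply: map_f; rewrite mem_filter ss mem_enum.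
have [i iE] : exists i, tnth (in_tuple (slots D steps)) i = (e, s).
  by have /tnthP[i ->] : (e, s) \in in_tuple (slots D steps) by []; exists i.
by apply: rational_ext (rational_param _ _ i) => x _; rewrite /slot_value iE.
Qed.

(** Along the construction every vector is the solution of an invertible system
    whose coefficients and right-hand side are rational by induction. *)
Lemma rational_vec_of e t : rational (fun x => vec_of x e t ord0).
Proof.
suff H s done : construction_wf I done s -> {subset s <= steps} ->
    (forall e, e \in done -> forall t, rational (fun x => vec_of x e t ord0)) ->
    forall e t, rational (fun x => vec_of x e t ord0).
  by apply: (H steps [::]).
elim: s done => [|[e1 ys] s IH] done /=.
  by move=> all_done _ done_rat e' t'; exact: done_rat.
move=> [_ ye yp ysd wf] sub done_rat; apply: IH wf _ _.
  by move=> u us; apply: sub; rewrite inE us orbT.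
have e1s : (e1, ys) \in steps by apply: sub; rewrite inE eqxx.
move=> e'; rewrite inE => /orP[/eqP-> t'|]; last exact: done_rat.
apply: (@rational_ext _ _ _ _ _ (fun x =>
    \sum_s invmx (step_mx c x e1 ys) t' s * step_rhs c x e1 ys s ord0)).
  move=> x [Ix /(_ _ e1s) /= xu].
  by rewrite -[vec_of x e1](mulKmx xu) (step_mx_vec_of _ Ix ye) [RHS]mxE.
apply: rational_sum => s' _; apply: rationalM.
  apply: rational_inv => [s1 t1|x [_ /(_ _ e1s)] //].
  have [s1y|s1y] := ltnP s1 (size ys).
    apply: (@rational_ext _ _ _ _ _ (fun x => vec_of x (nth e1 ys s1) t1 ord0)).
      by move=> x _; rewrite mxE s1y.
    by apply: done_rat; apply: ysd; rewrite mem_nth.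
  apply: (@rational_ext _ _ _ _ _ (fun x => (t1 == c e1 s1)%:R)).
    by move=> x _; rewrite mxE ltnNge s1y.
  exact: rational_cst.
have [s1y|s1y] := ltnP s' (size ys).
  apply: (@rational_ext _ _ _ _ _ (fun x => 1)); last exact: rational_cst.
  by move=> x _; rewrite mxE s1y.
apply: (@rational_ext _ _ _ _ _ (fun x => vec_of x e1 (c e1 s') ord0)).
  by move=> x _; rewrite mxE ltnNge s1y.
exact: rational_slot e1s s1y.
Qed.

Lemma rational_coord k : rational (fun x => x ord0 k).
Proof.
case/mxvec_indexP: k => t b.
have vE (x : point) : x ord0 (mxvec_index t b) = vec_mx x t b by rewrite mxE.
case: (splitP b) => [i bi|j bj].
  apply: rational_ext (rational_vec_of (inl i) t) => x _; rewrite vE /= !mxE.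
  by congr (x ord0 (mxvec_index t _)); apply: val_inj.
apply: rational_ext (rational_vec_of (inr j) t) => x _; rewrite vE /= !mxE.
by congr (x ord0 (mxvec_index t _)); apply: val_inj.
Qed.

End Steps.

Lemma monom_map (A B : comNzRingType) (phi : {rmorphism A -> B}) (fs : seq A) e :
  phi (monom fs e) = monom (map phi fs) e.
Proof.
elim: fs e => [|f fs IH] [|a e] //=; rewrite ?rmorph1 //.
by rewrite rmorphM rmorphXn IH.
Qed.

(** There is one chart for every function of type [chart], and on each of them
    the coordinates are rational functions of the [r] slots. *)
Lemma construction_chain_le (steps : construction n m) r :
  construction_wf I [::] steps -> size (slots D steps) = r ->
  forall l (P : 'I_l.+1 -> {pred {mpoly R[D * (n + m)]}}),
    prime_chain (vanishing_ideal (@pair_space R d n m I)) P -> (l <= r)%N.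
Proof.
move=> wf <-; apply: (@chain_length_le _ _ _ _ chart (@chart_set steps)) => [x Ix|c fs szfs].
  by have [c cx] := chart_exists Ix wf; exists c.
pose ev (f : {mpoly R[D * (n + m)]}) (x : point) := f.@[fun i => x ord0 i].
have [||s swf s0] := @rational_dependent R _ point (chart_set steps c)
    (@slot_value steps c) (map ev fs).
- by rewrite size_map.
- move=> i; rewrite (nth_map 0) ?szfs //.
  by apply: rational_meval => k; exact: rational_coord.
exists s => // x cx; rewrite -[RHS](s0 x cx) /eval_relation raddf_sum /=.
apply: eq_bigr => t _; rewrite mevalZ -map_comp.
by rewrite (@monom_map _ _ (meval (fun i => x ord0 i))).
Qed.

End Charts.

(** * Moving in a tangent direction *)

Lemma mulmx_coord_bound (R : realType) m N (L : 'M[R]_(m, N)) :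
  exists2 K, 0 < K & forall (w : 'rV[R]_m) b, 0 <= b ->
    (forall e, `|w ord0 e| <= b) -> forall i, `|(w *m L) ord0 i| <= b * K.
Proof.
exists (1 + \sum_e \sum_i `|L e i|) => [|w b b0 wb i].
  by rewrite ltr_wpDr ?ltr01 // sumr_ge0 // => e _; rewrite sumr_ge0.
rewrite mxE (le_trans (ler_norm_sum _ _ _)) //.
apply: (@le_trans _ _ (\sum_e b * \sum_i `|L e i|)).
  apply: ler_sum => e _; rewrite normrM ler_pM //.
  by rewrite (bigD1 i) //= lerDl sumr_ge0.
by rewrite -mulr_sumr ler_wpM2l // lerDr.
Qed.

(** [J] is the Jacobian matrix of [F] at [p], with a left inverse [L] in the row
    convention, so the equations are independent.  A fixed point of
    [x |-> x J L - F x L + z] with [z = q - q J L + eta d] satisfies [F x L = z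
    - x + x J L]; multiplication by [J], where [L J = 1] and [z J = 0], gives
    [F x = 0], and then [x - x J L = z].  The map is a contraction near [p],
    because it differs from a constant by the error term of the linear
    approximation of [F].  Points [q] other than [p] are needed since the lower
    bound moves in several directions one after the other. *)
Lemma solve_in_direction (R : realType) N m (F : 'rV[R]_N -> 'rV[R]_m)
    (J : 'M[R]_(N, m)) (L : 'M[R]_(m, N)) (p : 'rV[R]_N) (C : R) :
  L *m J = 1%:M -> 0 <= C ->
  (forall x y eps b, near_pt p eps x -> near_pt p eps y -> near_pt y b x ->
     0 <= eps -> 0 <= b ->
     forall e, `|(F x - F y - (x - y) *m J) ord0 e| <= C * eps * b) ->
  exists2 eps0, 0 < eps0 & forall q d, near_pt p eps0 q -> F q = 0 ->
    d *m J = 0 -> forall delta, 0 < delta ->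
    exists eta, 0 < eta /\ exists q', [/\ near_pt q delta q', F q' = 0
      & q' - q' *m J *m L = q - q *m J *m L + eta *: d].
Proof.
move=> LJ C0 Fdiff.
have [K K0 LK] := mulmx_coord_bound L.
have D0 : 0 < 4 * K * (C + 1) by rewrite !mulr_gt0 // ltr_wpDl.
(* Points within r of q are within 2 * eps0 of p, so the contraction factor is
   at most 2 * K * C * eps0, which is at most 1/2. *)
exists (4 * K * (C + 1))^-1 => [|q d pq Fq dJ delta delta0].
  by rewrite invr_gt0.
set eps0 := (_)^-1 in pq *.
have eps00 : 0 < eps0 by rewrite invr_gt0.
pose r := Num.min delta eps0.
have r0 : 0 < r by rewrite lt_min delta0.
pose B := 1 + \sum_i `|d ord0 i|.
have B0 : 0 < B by rewrite ltr_wpDr ?ltr01 // sumr_ge0.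
pose eta := r / 2 / B.
have eta0 : 0 < eta by rewrite !divr_gt0.
exists eta; split=> //.
pose z := q - q *m J *m L + eta *: d.
pose T x := x *m J *m L - F x *m L + z.
have [|||q' qq' Tq'] := @Contraction.contraction_fixpoint R N T q r.
- exact: ltW.
- move=> x y b qx qy xy i.
  have b0 : 0 <= b by apply: le_trans (xy i).
  have near2 u : near_pt q r u -> near_pt p (2 * eps0) u.
    move=> qu j; rewrite -(subrK (q ord0 j) (u ord0 j)) -addrA.
    rewrite (le_trans (ler_normD _ _)) // mulr_natl mulr2n lerD //.
    by rewrite (le_trans (qu j)) // ge_min lexx orbT.
  have TE : T x - T y = - ((F x - F y - (x - y) *m J) *m L).
    rewrite /T !mulmxBl; set a1 := x *m J *m L; set a2 := y *m J *m L.
    set a3 := F x *m L; set a4 := F y *m L.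
    by rewrite opprD addrACA subrr addr0 !opprB addrC; apply/rowP => j; rewrite !mxE; ring.
  have -> : T x ord0 i - T y ord0 i = (T x - T y) ord0 i by rewrite !mxE.
  rewrite TE mxE normrN.
  have CE0 : 0 <= C * (2 * eps0) * b.
    by rewrite mulr_ge0 // mulr_ge0 // mulr_ge0 // ltW.
  apply: le_trans (LK _ _ CE0 _ i) _.
    by apply: Fdiff => //; [exact: near2|exact: near2|rewrite mulr_ge0 // ltW].
  have -> : C * (2 * eps0) * b * K = (2 * K * C * eps0) * b by ring.
  rewrite [X in _ <= X]mulrC ler_wpM2r //.
  rewrite /eps0 ler_pdivrMr //; lra.
- move=> i; rewrite /T Fq mul0mx subr0 /z.
  rewrite !mxE; set w := \sum_j _; rewrite addrC -!addrA.
  have -> : q ord0 i + (- w + (eta * d ord0 i + (w - q ord0 i))) = eta * d ord0 i.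
    by ring.
  rewrite normrM gtr0_norm // (_ : eta * _ = r / 2 * (B^-1 * `|d ord0 i|)); last by rewrite mulrA.
  rewrite ler_piMr //.
    by rewrite divr_ge0 // ltW.
  rewrite mulrC ler_pdivrMr // mul1r /B (bigD1 i) //= addrCA lerDl.
  by rewrite addr_ge0 // sumr_ge0.
have Fq' : F q' = 0.
  have := congr1 (mulmx^~ J) Tq'; rewrite /T /z !(mulmxDl, mulNmx) -!mulmxA LJ.
  rewrite !mulmx1 subrr add0r -scalemxAl dJ scaler0 addr0.
  by move/eqP; rewrite addrC -subr_eq0 addrK oppr_eq0 => /eqP.
exists q'; split=> //.
  by move=> i; rewrite (le_trans (qq' i)) // ge_min lexx.
by rewrite -{1}Tq' /T Fq' mul0mx subr0 addrC addKr.
Qed.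

(** * Continuity of polynomial functions *)

Section Continuity.
Variables (R : realType) (N : nat) (q : 'rV[R]_N).

Definition cont_at (h : 'rV[R]_N -> R) := forall eps, 0 < eps ->
  exists2 delta, 0 < delta & forall x, near_pt q delta x -> `|h x - h q| < eps.

Lemma near_le delta delta' x : delta <= delta' -> near_pt q delta x -> near_pt q delta' x.
Proof. by move=> dd qx i; exact: le_trans dd. Qed.

Lemma cont_cst c : cont_at (fun=> c).
Proof. by move=> eps e0; exists 1 => // x _; rewrite subrr normr0. Qed.

Lemma cont_coord i : cont_at (fun x => x ord0 i).
Proof.
move=> eps e0; exists (eps / 2) => [|x /(_ i) xi]; first by rewrite divr_gt0.
by rewrite (le_lt_trans xi) // ltr_pdivrMr // ltr_pMr // ltr1n.
Qed.

Lemma contD h k : cont_at h -> cont_at k -> cont_at (fun x => h x + k x).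
Proof.
move=> hc kc eps e0; have e20 : 0 < eps / 2 by rewrite divr_gt0.
have [d1 d10 hd] := hc _ e20; have [d2 d20 kd] := kc _ e20.
exists (Num.min d1 d2) => [|x xq]; first by rewrite lt_min d10.
rewrite opprD addrACA (le_lt_trans (ler_normD _ _)) // [eps]splitr ltrD //.
  by apply: hd; apply: near_le xq; rewrite ge_min lexx.
by apply: kd; apply: near_le xq; rewrite ge_min lexx orbT.
Qed.

Lemma contM h k : cont_at h -> cont_at k -> cont_at (fun x => h x * k x).
Proof.
move=> hc kc eps e0.
pose B := `|h q| + `|k q| + 1; have B0 : 0 < B by rewrite ltr_wpDl // addr_ge0.
(* The bound 1 keeps k x below B; the other one gives e1 * B <= eps / 2. *)
pose e1 := Num.min 1 (eps / (2 * B)).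
have e10 : 0 < e1 by rewrite lt_min ltr01 divr_gt0 // mulr_gt0.
have [d1 d10 hd] := hc _ e10; have [d2 d20 kd] := kc _ e10.
exists (Num.min d1 d2) => [|x xq]; first by rewrite lt_min d10.
have hx : `|h x - h q| < e1 by apply: hd; apply: near_le xq; rewrite ge_min lexx.
have kx : `|k x - k q| < e1 by apply: kd; apply: near_le xq; rewrite ge_min lexx orbT.
have kx1 : `|k x| < B.
  rewrite -[k x](subrK (k q)) (le_lt_trans (ler_normD _ _)) //.
  have kx2 : `|k x - k q| < 1 by rewrite (lt_le_trans kx) // ge_min lexx.
  rewrite /B; have := normr_ge0 (h q); lra.
have -> : h x * k x - h q * k q = (h x - h q) * k x + h q * (k x - k q) by ring.
have e1B : e1 * B <= eps / 2.
  have : e1 <= eps / (2 * B) by rewrite ge_min lexx orbT.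
  by rewrite ler_pdivlMr ?mulr_gt0 // ler_pdivlMr // mulrA mulrAC.
rewrite (le_lt_trans (ler_normD _ _)) // !normrM [eps]splitr ltr_leD //.
  by rewrite (lt_le_trans _ e1B) // ltr_pM.
rewrite (le_trans _ e1B) // [e1 * B]mulrC ler_pM //; last exact: ltW.
by rewrite /B -addrA lerDl addr_ge0.
Qed.

Lemma cont_sum (I : Type) (s : seq I) (P : pred I) (h : I -> 'rV[R]_N -> R) :
  (forall i, cont_at (h i)) -> cont_at (fun x => \sum_(i <- s | P i) h i x).
Proof.
move=> hc; elim: s => [|i s IH].
  by move=> eps e0; exists 1 => // x _; rewrite !big_nil subrr normr0.
move=> eps e0; case Pi: (P i); last first.
  by have [d d0 hd] := IH _ e0; exists d => // x xq; rewrite !big_cons Pi; exact: hd.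
have [d d0 hd] := contD (hc i) IH e0.
by exists d => // x xq; rewrite !big_cons Pi; exact: hd.
Qed.

Lemma cont_prod (I : Type) (s : seq I) (P : pred I) (h : I -> 'rV[R]_N -> R) :
  (forall i, cont_at (h i)) -> cont_at (fun x => \prod_(i <- s | P i) h i x).
Proof.
move=> hc; elim: s => [|i s IH].
  by move=> eps e0; exists 1 => // x _; rewrite !big_nil subrr normr0.
move=> eps e0; case Pi: (P i); last first.
  by have [d d0 hd] := IH _ e0; exists d => // x xq; rewrite !big_cons Pi; exact: hd.
have [d d0 hd] := contM (hc i) IH e0.
by exists d => // x xq; rewrite !big_cons Pi; exact: hd.
Qed.

Lemma cont_meval (f : {mpoly R[N]}) : cont_at (fun x => f.@[fun i => x ord0 i]).
Proof.
move=> eps e0.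
have [|d d0 fd] := @cont_sum _ (msupp f) xpredT
    (fun m x => f@_m * \prod_i x ord0 i ^+ m i) _ eps e0.
  move=> m; apply: contM; first exact: cont_cst.
  apply: cont_prod => i; elim: (m i) => [|k IH].
    by move=> e' e'0; exists 1 => // x _; rewrite !expr0 subrr normr0.
  move=> e' e'0; have [d d0 hd] := contM (cont_coord i) IH e'0.
  by exists d => // x xq; rewrite !exprS; exact: hd.
by exists d => // x xq; rewrite !mevalE; exact: fd.
Qed.

End Continuity.

(** * A chain of primes at a stress-free realization *)

Lemma mul_lin1_mx (R : realType) N M (f : 'rV[R]_N -> 'rV[R]_M) x :
  (forall a u v, f (a *: u + v) = a *: f u + f v) -> x *m lin1_mx f = f x.
Proof.
move=> flin.
pose F : {linear 'rV[R]_N -> 'rV[R]_M} :=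
  HB.pack f (GRing.isLinear.Build R 'rV[R]_N 'rV[R]_M *:%R f flin).
exact: (mul_rV_lin1 F).
Qed.

Lemma ideal_vanishing (R : realType) N (S : set 'rV[R]_N) : ideal (vanishing_ideal S).
Proof.
split=> [x _|a u v Iu Iv x Sx]; first by rewrite meval0.
by rewrite mevalD mevalM Iu // Iv // mulr0 addr0.
Qed.

Section LowerBound.
Variables (R : realType) (d n m M : nat) (I : 'I_n -> 'I_m -> bool).
Local Notation D := d.+1.
Local Notation N := (D * (n + m))%N.
Local Notation point := 'rV[R]_N.
Variables (pr : 'I_M -> 'I_n * 'I_m) (p : point).
Hypothesis pr_inc : forall e, I (pr e).1 (pr e).2.
Hypothesis pr_surj : forall i j, I i j -> exists e, pr e = (i, j).
Hypothesis Ip : pair_space I p.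
Local Notation vx x i := (vec_of x (inl i)).
Local Notation fx x j := (vec_of x (inr j)).
(* A self-stress assigns weights to the incidences so that at each vertex the
   weighted normals, and at each facet the weighted vertices, add up to 0; it
   is a linear relation between the gradients of the incidence equations. *)
Hypothesis stress_free : forall w : 'I_M -> R,
  (forall i t, \sum_(e | (pr e).1 == i) w e * fx p (pr e).2 t ord0 = 0) ->
  (forall j t, \sum_(e | (pr e).2 == j) w e * vx p (pr e).1 t ord0 = 0) ->
  forall e, w e = 0.

Definition pairing (x y : point) : 'rV[R]_M :=
  \row_e dotv (fx x (pr e).2) (vx y (pr e).1).

Lemma pairingE x y e : pairing x y ord0 e = dotv (fx x (pr e).2) (vx y (pr e).1).
Proof. by rewrite mxE. Qed.

Lemma vec_of_lin (a : R) (x y : point) e : vec_of (a *: x + y) e = a *: vec_of x e + vec_of y e.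
Proof. by case: e => k; apply/colP => t; rewrite /= !mxE. Qed.

Lemma pairing_linl a x x' y : pairing (a *: x + x') y = a *: pairing x y + pairing x' y.
Proof. by apply/rowP => e; rewrite !mxE vec_of_lin dotvDl dotvZl. Qed.

Lemma pairing_linr a x y y' : pairing x (a *: y + y') = a *: pairing x y + pairing x y'.
Proof. by apply/rowP => e; rewrite !mxE vec_of_lin dotvDr dotvZr. Qed.

Lemma pairingBl x x' y : pairing (x - x') y = pairing x y - pairing x' y.
Proof. by rewrite addrC -scaleN1r pairing_linl scaleN1r addrC. Qed.

Lemma pairingBr x y y' : pairing x (y - y') = pairing x y - pairing x y'.
Proof. by rewrite addrC -scaleN1r pairing_linr scaleN1r addrC. Qed.

Definition incidence_map (x : point) : 'rV[R]_M := pairing x x - const_mx 1.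

(** The derivative at [p] of the quadratic map [x |-> pairing x x], as a matrix
    that acts on row vectors. *)
Definition jacobian := lin1_mx (fun x => pairing x p + pairing p x).

Lemma mul_jacobian x : x *m jacobian = pairing x p + pairing p x.
Proof.
rewrite mul_lin1_mx // => a u v; rewrite pairing_linl pairing_linr scalerDr.
by rewrite addrACA.
Qed.

Lemma vec_of_coord e t : exists k, forall y : point, vec_of y e t ord0 = y ord0 k.
Proof.
case: e => i; first by exists (mxvec_index t (lshift m i)) => y; rewrite !mxE.
by exists (mxvec_index t (rshift n i)) => y; rewrite !mxE.
Qed.

Lemma pairing_bound (x y : point) b b' e :
  (forall k, `|x ord0 k| <= b) -> (forall k, `|y ord0 k| <= b') ->
  `|pairing x y ord0 e| <= D%:R * (b * b').
Proof.
move=> xb yb'; rewrite mxE dotvE (le_trans (ler_norm_sum _ _ _)) //.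
rewrite mulr_natl -[X in _ <= _ *+ X](card_ord D) -sumr_const.
apply: ler_sum => t _; rewrite normrM ler_pM //.
  by have [k ->] := vec_of_coord (inr (pr e).2) t.
by have [k ->] := vec_of_coord (inl (pr e).1) t.
Qed.

(** The map is quadratic, so the error of the linear approximation is exactly
    [pairing (x - p) (x - y) + pairing (x - y) (y - p)]. *)
Lemma incidence_map_diff (x y : point) eps b :
  near_pt p eps x -> near_pt p eps y -> near_pt y b x ->
  0 <= eps -> 0 <= b -> forall e,
  `|(incidence_map x - incidence_map y - (x - y) *m jacobian) ord0 e| <=
    (2 * D%:R) * eps * b.
Proof.
move=> px py yx eps0 b0 e.
have -> : incidence_map x - incidence_map y - (x - y) *m jacobian =
    pairing (x - p) (x - y) + pairing (x - y) (y - p).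
  rewrite mul_jacobian /incidence_map !pairingBl !pairingBr.
  by apply/rowP => k; rewrite !mxE; ring.
rewrite mxE (le_trans (ler_normD _ _)) //.
have -> : 2 * D%:R * eps * b = D%:R * (eps * b) + D%:R * (b * eps) :> R by ring.
rewrite lerD // pairing_bound // => k; rewrite !mxE; [exact: px|exact: yx|exact: yx|exact: py].
Qed.

Lemma vec_of_vertexE (x : point) i t : vx x i t ord0 = vec_mx x t (lshift m i).
Proof. by rewrite /vec_of mxE [LHS]mxE. Qed.

Lemma vec_of_facetE (x : point) j t : fx x j t ord0 = vec_mx x t (rshift n j).
Proof. by rewrite /vec_of mxE [LHS]mxE. Qed.

(** The product of [w] with the column of a coordinate is the corresponding
    equilibrium equation of the stress [w]. *)
Lemma jacobian_free : row_free jacobian^T.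
Proof.
apply: inj_row_free => w wJ; apply/rowP => e; rewrite [RHS]mxE.
have vec_delta t b s c : vec_mx (delta_mx 0 (mxvec_index t b) : point) s c =
    ((s == t) && (c == b))%:R.
  by rewrite vec_mx_delta mxE.
have wk k : \sum_e w ord0 e * (pairing (delta_mx 0 k) p + pairing p (delta_mx 0 k)) ord0 e = 0.
  have := congr1 (fun A : 'rV[R]_N => A ord0 k) wJ; rewrite mxE [RHS]mxE => E.
  rewrite -[RHS]E; apply: eq_bigr => e' _; congr (_ * _).
  by rewrite [RHS]mxE [RHS]mxE.
have dot_delta (c : 'cV[R]_D) t (f : bool) : \sum_s c s ord0 * ((s == t) && f)%:R =
    (if f then c t ord0 else 0) :> R.
  case: f; last by apply: big1 => s _; rewrite andbF mulr0.
  rewrite (bigD1 t) //= eqxx mulr1 big1 ?addr0 // => s /negPf->.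
  by rewrite mulr0.
apply: (stress_free (w := w ord0)) => [i t|j t].
  rewrite -[RHS](wk (mxvec_index t (lshift m i))) big_mkcond /=.
  apply: eq_bigr => e' _; rewrite [in RHS]mxE !pairingE.
  rewrite [dotv _ (vx p _)]dotvE big1 ?add0r => [|s _]; last first.
    by rewrite vec_of_facetE vec_delta eq_rlshift andbF mul0r.
  rewrite dotvE (eq_bigr (fun s => fx p (pr e').2 s ord0 * ((s == t) && ((pr e').1 == i))%:R)).
    by rewrite dot_delta; case: eqP => _ //; rewrite mulr0.
  by move=> s _; rewrite vec_of_vertexE vec_delta eq_lshift.
rewrite -[RHS](wk (mxvec_index t (rshift n j))) big_mkcond /=.
apply: eq_bigr => e' _; rewrite [in RHS]mxE !pairingE.
rewrite [dotv (fx p _) _]dotvE [X in _ = _ * (_ + X)]big1 ?addr0 => [|s _]; last first.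
  by rewrite vec_of_vertexE vec_delta eq_lrshift andbF mulr0.
rewrite dotvC dotvE (eq_bigr (fun s => vx p (pr e').1 s ord0 * ((s == t) && ((pr e').2 == j))%:R)).
  by rewrite dot_delta; case: eqP => _ //; rewrite mulr0.
by move=> s _; rewrite vec_of_facetE vec_delta eq_rshift.
Qed.

Lemma incidence_map0 (x : point) : pair_space I x -> incidence_map x = 0.
Proof.
move=> Ix; apply/rowP => e; rewrite !mxE.
have /eqP -> : dotv (fx x (pr e).2) (vx x (pr e).1) == 1.
  by rewrite (incidence_eq1 _ _ Ix) pr_inc.
by rewrite subrr.
Qed.

(** The inequalities are strict at [p] and finitely many, so near [p] only the
    equations matter. *)
Lemma pair_space_open : exists2 eps, 0 < eps & forall x, near_pt p eps x ->
  incidence_map x = 0 -> pair_space I x.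
Proof.
have epsP (ij : 'I_n * 'I_m) : exists eps, 0 < eps /\ (~~ I ij.1 ij.2 ->
    forall x, near_pt p eps x -> dotv (fx x ij.2) (vx x ij.1) < 1).
  have [Iij|nIij] := boolP (I ij.1 ij.2); first by exists 1.
  have lt1 : dotv (fx p ij.2) (vx p ij.1) < 1.
    by have := Ip ij.1 ij.2; rewrite (negPf nIij).
  have [||eps e0 he] := @cont_sum R N p _ (index_enum 'I_D) xpredT
      (fun t x => fx x ij.2 t ord0 * vx x ij.1 t ord0) _ (1 - dotv (fx p ij.2) (vx p ij.1)).
    move=> t; apply: contM.
      have [k kE] := vec_of_coord (inr ij.2) t.
      by move=> eps e0; have [dl dl0 h] := cont_coord p k e0; exists dl => // x; rewrite !kE; exact: h.
    have [k kE] := vec_of_coord (inl ij.1) t.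
    by move=> eps e0; have [dl dl0 h] := cont_coord p k e0; exists dl => // x; rewrite !kE; exact: h.
    by rewrite subr_gt0.
  exists eps; split=> // _ x px; have := he x px; rewrite -!dotvE => h.
  by have := le_lt_trans (ler_norm _) h; rewrite ltrD2r.
have [eps {}epsP] := choice epsP.
exists (\big[Num.min/1]_ij eps ij) => [|x px x0].
  by apply: (big_ind (fun y => 0 < y)) => // [y z y0 z0|ij _]; [rewrite lt_min y0|case: (epsP ij)].
move=> i j; case: ifPn => [Iij|nIij].
  have [e eE] := pr_surj Iij; have := congr1 (fun u : 'rV[R]_M => u ord0 e) x0.
  by rewrite !mxE eE /= => /eqP; rewrite subr_eq0 => /eqP.
have [_ /(_ nIij) h] := epsP (i, j); apply: h; apply: near_le px; exact: bigmin_le.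
Qed.

(** The forms [f k] are coordinates along a basis of the tangent space, and
    [solve_in_direction] changes one of them while it keeps the others and
    the equations.  This produces, close to [p], solutions at which a given
    element of the flag monoid does not vanish.  Work from the inside: at a
    solution where [f 0, ..., f k] vanish and the inner element [h] does not,
    [h + a f_k] does not vanish either; move a little so that [f k] becomes
    nonzero and the earlier forms stay 0. *)
Lemma stress_free_prime_chain : (M <= N)%N ->
  exists P : 'I_(N - M).+1 -> {pred {mpoly R[N]}},
    prime_chain (vanishing_ideal (@pair_space R d n m I)) P.
Proof.
move=> MN.
have rankJ : \rank jacobian = M by rewrite -mxrank_tr; apply/eqP; exact: jacobian_free.
have [L LJ] : exists L, L *m jacobian = 1%:M.
  by apply/row_fullP; rewrite /row_full rankJ.
have [eps1 eps10 open1] := pair_space_open.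
have [|eps0 eps00 solve] := @solve_in_direction R N M incidence_map jacobian L p
  (2 * D%:R) LJ _ incidence_map_diff; first by rewrite mulr_ge0.
set K := row_base (kermx jacobian); set r := \rank (kermx jacobian) in K.
have rE : r = (N - M)%N by rewrite /r mxrank_ker rankJ.
have KJ : K *m jacobian = 0 by apply/sub_kermxP; rewrite eq_row_base.
have KU : K *m pinvmx K = 1%:M by apply: mulmxVp; exact: row_base_free.
(* x - x *m jacobian *m L is the part of x in the kernel of the Jacobian matrix,
   which moves by eta *: d in solve_in_direction; W gives its coordinates in the
   basis K. *)
pose W := (1%:M - jacobian *m L) *m pinvmx K.
pose f k : {mpoly R[N]} := \sum_i W i k *: 'X_i - ((p *m W) ord0 k)%:MP.
have fE k (x : point) : (f k).@[fun i => x ord0 i] = ((x - p) *m W) ord0 k.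
  rewrite mevalB mevalC mulmxBl [RHS]mxE [X in _ = _ + X]mxE; congr (_ - _).
  rewrite raddf_sum mxE /=; apply: eq_bigr => i _.
  by rewrite mevalZ mevalXU mulrC.
rewrite -rE; pose xs := [seq f k | k <- enum 'I_r].
have szxs : size xs = r by rewrite size_map size_enum_ord.
rewrite -szxs; apply: prime_chain_of_flag; first exact: ideal_vanishing.
pose eps := Num.min eps0 eps1.
have e0 : 0 < eps by rewrite lt_min eps00.
(* Induction on the number c of forms that are not yet required to vanish. *)
suff H c k : (k + c = r)%N -> forall g, flag_monoid (drop k xs) g ->
    forall e, 0 < e -> e <= eps -> exists q, [/\ near_pt p e q, incidence_map q = 0,
      forall j : 'I_r, (j < k)%N -> (f j).@[fun i => q ord0 i] = 0
      & g.@[fun i => q ord0 i] != 0].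
  move=> g Ig gx; have gx0 : flag_monoid (drop 0 xs) g by rewrite drop0.
  have [q [pq q0 _]] := H r 0%N (add0n r) g gx0 eps e0 (lexx _).
  rewrite Ig ?eqxx //; apply: open1 => //; apply: near_le pq.
  by rewrite /eps ge_min lexx orbT.
elim: c k => [|c IH] k kc g.
  have -> : drop k xs = [::] by rewrite drop_oversize // szxs -kc addn0.
  move=> /= -> e e'0 ee.
  exists p; split=> [i||j _|]; rewrite ?subrr ?normr0 ?ltW ?meval1 ?oner_neq0 //.
    exact: incidence_map0.
  by rewrite fE subrr mul0mx mxE.
have kr : (k < r)%N by rewrite -kc addnS ltnS leq_addr.
rewrite (drop_nth 0) ?szxs //= => -[ex [a [h [hflag gE]]]] e e'0 ee.
have fk : xs`_k = f (Ordinal kr).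
  by rewrite (nth_map (Ordinal kr)) ?size_enum_ord // (nth_ord_enum _ (Ordinal kr)).
have e2 : 0 < e / 2 by rewrite divr_gt0.
have e2e : e / 2 <= e by rewrite ler_pdivrMr // ler_pMr // ler1n.
have [|q [pq q0 fq hq]] := IH k.+1 _ h hflag (e / 2) e2 (le_trans e2e ee).
  by rewrite addSnnS.
pose h' := h + a * xs`_k.
have h'q : h'.@[fun i => q ord0 i] != 0.
  by rewrite /h' mevalD mevalM fk fq // mulr0 addr0.
have [dl dl0 hdl] : exists2 dl, 0 < dl & forall x, near_pt q dl x ->
    h'.@[fun i => x ord0 i] != 0.
  have nq : 0 < `|h'.@[fun i => q ord0 i]| by rewrite normr_gt0.
  have [dl dl0 hd] := @cont_meval R N q h' _ nq.
  exists dl => // x /hd; apply: contraTneq => ->.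
  by rewrite sub0r normrN ltxx.
pose dd := Num.min dl (e / 2).
have dd0 : 0 < dd by rewrite lt_min dl0.
have [||eta [eta0 [q' [qq' q'0 q'E]]]] := solve q (row (Ordinal kr) K) _ q0 _ dd dd0.
- apply: near_le pq; rewrite (le_trans e2e) // (le_trans ee) //.
  by rewrite /eps ge_min lexx.
- by rewrite -row_mul KJ row0.
have fq' j : (f j).@[fun i => q' ord0 i] = (f j).@[fun i => q ord0 i] + eta * (Ordinal kr == j)%:R.
  have WE (x : point) : x *m W = (x - x *m jacobian *m L) *m pinvmx K.
    by rewrite /W mulmxA mulmxBr mulmx1 !mulmxA.
  rewrite !fE !mulmxBl !WE q'E mulmxDl -scalemxAl -row_mul KU.
  by rewrite !mxE addrAC; congr (_ + _ * _); rewrite eq_sym.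
exists q'; split=> //.
- move=> i; rewrite -(subrK (q ord0 i) (q' ord0 i)) -addrA.
  rewrite (le_trans (ler_normD _ _)) // [e]splitr lerD //.
  by rewrite (le_trans (qq' i)) // ge_min lexx orbT.
- move=> j jk; rewrite fq' fq ?add0r; last by rewrite ltnS ltnW.
  by rewrite -val_eqE /= gtn_eqF // mulr0.
rewrite gE mevalM rmorphXn mulf_neq0 //=.
  by rewrite expf_neq0 // fk fq' fq // add0r eqxx mulr1 gt_eqF.
apply: hdl; apply: near_le qq'; by rewrite ge_min lexx.
Qed.

End LowerBound.

(** * Integer data of the 24-cell *)

Local Open Scope Z_scope.

Definition vertex24 : seq (seq Z) := [::
  [:: 1; 1; 0; 0]; [:: 1; -1; 0; 0]; [:: -1; 1; 0; 0]; [:: -1; -1; 0; 0];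
  [:: 1; 0; 1; 0]; [:: 1; 0; -1; 0]; [:: -1; 0; 1; 0]; [:: -1; 0; -1; 0];
  [:: 1; 0; 0; 1]; [:: 1; 0; 0; -1]; [:: -1; 0; 0; 1]; [:: -1; 0; 0; -1];
  [:: 0; 1; 1; 0]; [:: 0; 1; -1; 0]; [:: 0; -1; 1; 0]; [:: 0; -1; -1; 0];
  [:: 0; 1; 0; 1]; [:: 0; 1; 0; -1]; [:: 0; -1; 0; 1]; [:: 0; -1; 0; -1];
  [:: 0; 0; 1; 1]; [:: 0; 0; 1; -1]; [:: 0; 0; -1; 1]; [:: 0; 0; -1; -1]].

(** Twice the normals, so that the product with an incident vertex is 2. *)
Definition facet24 : seq (seq Z) := [::
  [:: 2; 0; 0; 0]; [:: -2; 0; 0; 0]; [:: 0; 2; 0; 0]; [:: 0; -2; 0; 0];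
  [:: 0; 0; 2; 0]; [:: 0; 0; -2; 0]; [:: 0; 0; 0; 2]; [:: 0; 0; 0; -2];
  [:: 1; 1; 1; 1]; [:: 1; 1; 1; -1]; [:: 1; 1; -1; 1]; [:: 1; 1; -1; -1];
  [:: 1; -1; 1; 1]; [:: 1; -1; 1; -1]; [:: 1; -1; -1; 1]; [:: 1; -1; -1; -1];
  [:: -1; 1; 1; 1]; [:: -1; 1; 1; -1]; [:: -1; 1; -1; 1]; [:: -1; 1; -1; -1];
  [:: -1; -1; 1; 1]; [:: -1; -1; 1; -1]; [:: -1; -1; -1; 1]; [:: -1; -1; -1; -1]].

(** Twice the vertices of the regular 24-cell, with one zero coordinate of each
    replaced by 1 or -1.  The eight facets with normals along the axes keep
    their direction, and 48 of the 384 signed permutations that preserve the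
    regular 24-cell remain.  With the full group there are self-stresses, with
    these 48 symmetries there are none. *)
Definition vertex_gen : seq (seq Z) := [::
  [:: 2; 2; 1; 0]; [:: 2; -2; 0; -1]; [:: -2; 2; 0; 1]; [:: -2; -2; -1; 0];
  [:: 2; 1; 2; 0]; [:: 2; 0; -2; 1]; [:: -2; 0; 2; -1]; [:: -2; -1; -2; 0];
  [:: 2; 0; -1; 2]; [:: 2; -1; 0; -2]; [:: -2; 1; 0; 2]; [:: -2; 0; 1; -2];
  [:: 1; 2; 2; 0]; [:: 0; 2; -2; -1]; [:: 0; -2; 2; 1]; [:: -1; -2; -2; 0];
  [:: -1; 2; 0; 2]; [:: 0; 2; -1; -2]; [:: 0; -2; 1; 2]; [:: 1; -2; 0; -2];
  [:: 0; -1; 2; 2]; [:: -1; 0; 2; -2]; [:: 1; 0; -2; 2]; [:: 0; 1; -2; -2]].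

(** Ten times the normals, so that the product with an incident vertex is 10. *)
Definition facet_gen : seq (seq Z) := [::
  [:: 5; 0; 0; 0]; [:: -5; 0; 0; 0]; [:: 0; 5; 0; 0]; [:: 0; -5; 0; 0];
  [:: 0; 0; 5; 0]; [:: 0; 0; -5; 0]; [:: 0; 0; 0; 5]; [:: 0; 0; 0; -5];
  [:: 2; 2; 2; 4]; [:: 2; 2; 2; -4]; [:: 2; 4; -2; 2]; [:: 4; 2; -2; -2];
  [:: 4; -2; 2; 2]; [:: 2; -2; 4; -2]; [:: 2; -4; -2; 2]; [:: 2; -2; -4; -2];
  [:: -2; 2; 4; 2]; [:: -2; 4; 2; -2]; [:: -2; 2; -4; 2]; [:: -4; 2; -2; -2];
  [:: -4; -2; 2; 2]; [:: -2; -4; 2; -2]; [:: -2; -2; -2; 4]; [:: -2; -2; -2; -4]].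

(** Numbers below 24 stand for vertices and [24 + j] for the facet [j].  The
    lists have total length 140.  The equations used have independent
    differentials at every point, and the Jacobian matrix of the regular 24-cell
    has rank 140, so no order can use more incidences. *)
Definition construction24 : seq (nat * seq nat) := ([::
  (39, [::]); (20, [::]); (5, [:: 39]); (24, [:: 5]);
  (9, [:: 24; 39]); (35, [:: 5; 9]); (1, [:: 24; 39]); (23, [:: 35; 39]);
  (38, [:: 1; 5]); (29, [:: 5; 23]); (15, [:: 29; 38; 39]); (31, [:: 9; 23]);
  (0, [:: 24; 35]); (37, [:: 1; 9]); (19, [:: 31; 37; 39]); (47, [:: 15; 19; 23]);
  (27, [:: 1; 15; 19]); (7, [:: 29; 47]); (3, [:: 27; 47]); (46, [:: 3; 7; 15]);
  (22, [:: 29; 38; 46]); (18, [:: 27; 38; 46]); (36, [:: 1; 18; 20]); (44, [:: 3; 18; 20]);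
  (14, [:: 37; 27; 36; 44]); (8, [:: 24; 36; 38]); (43, [:: 7; 23]); (34, [:: 0; 5; 8; 22]);
  (13, [:: 34; 29; 35; 43]); (30, [:: 20; 8; 18; 22]); (4, [:: 24; 36; 37]); (32, [:: 0; 4; 8; 20]);
  (10, [:: 30; 44; 46]); (42, [:: 10; 7; 13; 22]); (16, [:: 32; 30; 34; 42]); (26, [:: 0; 13; 16]);
  (17, [:: 26; 31; 35; 43]); (33, [:: 4; 0; 9; 17]); (40, [:: 10; 16; 20]); (2, [:: 40; 26; 42; 43]);
  (12, [:: 33; 26; 32; 40]); (28, [:: 12; 4; 14; 20]); (21, [:: 28; 31; 33; 37]); (41, [:: 2; 12; 17; 21]);
  (6, [:: 41; 28; 40; 44]); (25, [:: 2; 3; 6; 10]); (11, [:: 25; 31; 41; 43]); (45, [:: 3; 6; 11; 21])])%N.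

Definition coordZ (T : seq (seq Z)) (i r : nat) : Z := nth 0 (nth [::] T i) r.

Definition dotZ (T U : seq (seq Z)) (i j : nat) : Z :=
  foldr (fun r s => coordZ U j r * coordZ T i r + s) 0 (iota 0 4).

Definition inc24 (i j : nat) : bool := Z.eqb (dotZ vertex24 facet24 i j) 2.

Definition pair_check (T U : seq (seq Z)) (N : Z) : bool :=
  all (fun i => all (fun j => if inc24 i j then Z.eqb (dotZ T U i j) N
                              else Z.ltb (dotZ T U i j) N) (iota 0 24)) (iota 0 24).

Definition pairs24 : seq (nat * nat) :=
  [seq p <- allpairs pair (iota 0 24) (iota 0 24) | inc24 p.1 p.2].

(** The equilibrium equations of a self-stress: an unknown for each incidence and
    an equation for each coordinate of each vertex and facet. *)
Definition stress_eqs (prs : seq (nat * nat)) (T U : seq (seq Z)) : seq (seq Z) :=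
  let rows := allpairs pair (iota 0 24) (iota 0 4) in
  [seq [seq if p.1 == x.1 then coordZ U p.2 x.2 else 0 | p <- prs] | x <- rows] ++
  [seq [seq if p.2 == x.1 then coordZ T p.1 x.2 else 0 | p <- prs] | x <- rows].

Fixpoint gcdl (r : seq Z) := if r is a :: r' then Z.gcd a (gcdl r') else 0.

(** Division by the common divisor keeps the entries small in the elimination.
    The final comparison makes the result proportional to the input without any
    property of [Z.gcd] or [Z.div]. *)
Definition normalize (r : seq Z) :=
  let g := gcdl r in
  let r' := [seq Z.div a g | a <- r] in
  if ~~ Z.eqb g 0 && ([seq g * a | a <- r'] == r) then r' else r.

Fixpoint comb (a b : Z) (s t : seq Z) : seq Z :=
  match s, t with
  | x :: s', y :: t' => (a * x - b * y) :: comb a b s' t'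
  | _, _ => [::]
  end.

(** Removes the leading unknown from the equation [r] by means of the pivot [p],
    with a cross multiplication that stays within the integers. *)
Definition reduce (p r : seq Z) :=
  if Z.eqb (head 0 r) 0 then behead r
  else normalize (comb (head 0 p) (head 0 r) (behead r) (behead p)).

Fixpoint extract (pre E : seq (seq Z)) : option (seq Z * seq (seq Z)) :=
  if E is r :: E' then
    if Z.eqb (head 0 r) 0 then extract (r :: pre) E' else Some (r, catrev pre E')
  else None.

(** Gaussian elimination succeeds if every unknown has a pivot, that is, if the
    system has only the zero solution. *)
Fixpoint elim (n : nat) (E : seq (seq Z)) : bool :=
  if n is n'.+1 then
    if extract [::] E is Some (p, E') then
      [&& size p == n, all (fun r => size r == n) E' & elim n' [seq reduce p r | r <- E']]
    else false
  else true.

Lemma pair_check24 : pair_check vertex24 facet24 2. Proof. by vm_compute. Qed.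

Lemma pair_check_gen : pair_check vertex_gen facet_gen 10. Proof. by vm_compute. Qed.

Lemma stress_eqs_elim : elim 144 (stress_eqs pairs24 vertex_gen facet_gen).
Proof. by vm_compute. Qed.

Section Elimination.
Variable R : realType.

Definition zr (z : Z) : R := ((int_of_Z z)%:~R)%R.

(** The unknowns are a function on all naturals, so that dropping the leading one
    is a shift. *)
Fixpoint lin (r : seq Z) (w : nat -> R) : R :=
  (if r is a :: r' then zr a * w 0%N + lin r' (fun k => w k.+1) else 0)%R.

Lemma zrD a b : zr (a + b) = (zr a + zr b)%R.
Proof. by rewrite /zr -rmorphD -(rmorphD int_of_Z). Qed.

Lemma zrM a b : zr (a * b) = (zr a * zr b)%R.
Proof. by rewrite /zr -rmorphM -(rmorphM int_of_Z). Qed.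

Lemma zrB a b : zr (a - b) = (zr a - zr b)%R.
Proof. by rewrite /zr -rmorphB -(rmorphB int_of_Z). Qed.

Lemma zr_eq0 a : (zr a == 0)%R = Z.eqb a 0.
Proof.
rewrite /zr intr_eq0; apply/idP/idP => [/eqP a0|/Z.eqb_spec ->//].
by apply/Z.eqb_spec; lia.
Qed.

Lemma zr_lt a b : Z.ltb a b -> (zr a < zr b)%R.
Proof. by move/Z.ltb_spec0 => ab; rewrite /zr ltr_int; lia. Qed.

Lemma lin_sum r w : lin r w = (\sum_(k < size r) zr (nth 0 r k) * w k)%R.
Proof.
elim: r w => [|a r IH] w /=; first by rewrite big_ord0.
by rewrite big_ord_recl /= IH.
Qed.

Lemma lin_eq0 r w : (forall k, (k < size r)%N -> w k = 0%R) -> lin r w = 0%R.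
Proof. by move=> w0; rewrite lin_sum big1 // => k _; rewrite w0 ?mulr0. Qed.

Lemma lin_scale g r w : lin [seq g * a | a <- r] w = (zr g * lin r w)%R.
Proof.
elim: r w => [|a r IH] w /=; first by rewrite mulr0.
by rewrite IH zrM mulrDr mulrA.
Qed.

Lemma lin_comb a b s t w : size s = size t ->
  lin (comb a b s t) w = (zr a * lin s w - zr b * lin t w)%R.
Proof.
elim: s t w => [|x s IH] [|y t] w //= => [_|[st]]; first by rewrite !mulr0 subr0.
by rewrite IH // zrB !zrM; ring.
Qed.

Lemma normalize_lin r w : lin r w = 0%R -> lin (normalize r) w = 0%R.
Proof.
rewrite /normalize; set g := gcdl r; set r' := [seq Z.div a g | a <- r].
case: ifP => // /andP[g0 /eqP rE]; rewrite -{1}rE lin_scale => /eqP.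
by rewrite mulf_eq0 zr_eq0 (negPf g0) => /eqP.
Qed.

Lemma reduce_lin p r w : size p = size r -> lin p w = 0%R -> lin r w = 0%R ->
  lin (reduce p r) (fun k => w k.+1) = 0%R.
Proof.
case: p r => [|a p] [|b r] //= [pr] p0 r0; rewrite /reduce /=.
case: ifP => [/Z.eqb_spec b0|_].
  by move: r0; rewrite b0 /zr /= mul0r add0r.
apply: normalize_lin; rewrite lin_comb //.
have -> : lin r (fun k => w k.+1) = (- (zr b * w 0%N))%R by apply/eqP; rewrite -addr_eq0 addrC r0.
have -> : lin p (fun k => w k.+1) = (- (zr a * w 0%N))%R by apply/eqP; rewrite -addr_eq0 addrC p0.
by ring.
Qed.

Lemma extractP pre E p E' : extract pre E = Some (p, E') ->
  Z.eqb (head 0 p) 0 = false /\ forall r, r \in p :: E' -> r \in pre \/ r \in E.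
Proof.
elim: E pre => [//|r E IH] pre /=; case: ifP => [_ /IH[p0 sub]|r0 [<- <-]].
  split=> // q /sub; rewrite !inE => -[/orP[->|]|->]; rewrite ?orbT; by [right|left].
split=> // q; rewrite !inE catrevE mem_cat mem_rev => /orP[->|/orP[->|->]]; rewrite ?orbT; by [right|left].
Qed.

Lemma elim_sound n E w : elim n E -> (forall r, r \in E -> lin r w = 0%R) ->
  forall k, (k < n)%N -> w k = 0%R.
Proof.
elim: n E w => [//|n IH] E w /=.
case Eq: extract => [[p E']|//] /and3P[/eqP szp /allP szE' El] E0.
have [p0 sub] := extractP Eq.
have lin0 r : r \in p :: E' -> lin r w = 0%R by move=> /sub[//|]; exact: E0.
have wS k : (k < n)%N -> w k.+1 = 0%R.
  apply: (IH _ (fun k => w k.+1) El) => _ /mapP[r rE' ->]; apply: reduce_lin.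
  - by rewrite szp (eqP (szE' _ rE')).
  - by apply: lin0; rewrite inE eqxx.
  - by apply: lin0; rewrite inE rE' orbT.
case=> [_|k]; last by rewrite ltnS; exact: wS.
have /= := lin0 p (mem_head _ _); case: (p) szp p0 => [//|a q] /= [szq] a0.
rewrite lin_eq0 ?addr0 => [/eqP|k]; last by rewrite szq; exact: wS.
by rewrite mulf_eq0 zr_eq0 a0 => /eqP.
Qed.

End Elimination.

Local Close Scope Z_scope.

(** * The incidences of the regular 24-cell *)

Definition I24 (i j : 'I_24) : bool := inc24 i j.

Lemma all_iota n (P : nat -> bool) : all P (iota 0 n) -> forall i : 'I_n, P i.
Proof. by move=> /allP H i; apply: H; rewrite mem_iota add0n ltn_ord. Qed.

Lemma ord_of_lt n k : (k < n)%N -> exists l : 'I_n, k = l.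
Proof. by move=> kn; exists (Ordinal kn). Qed.

Lemma has_iota n (P : nat -> bool) : has P (iota 0 n) -> exists i : 'I_n, P i.
Proof.
by move=> /hasP[k]; rewrite mem_iota add0n => kn Pk; exists (Ordinal kn).
Qed.

Section Tables.
Variable R : realType.

Definition table_mx (T : seq (seq Z)) (N : Z) : 'M[R]_(4, 24) :=
  \matrix_(r, i) (zr R (coordZ T i r) / zr R N).

Lemma dotv_table T U N (i j : 'I_24) :
  dotv (col j (table_mx U N)) (col i (table_mx T (Zpos xH))) = zr R (dotZ T U i j) / zr R N.
Proof.
rewrite dotvE !big_ord_recl big_ord0 /dotZ /= !mxE /= !zrD !zrM.
have -> : zr R (Zpos xH) = 1 by [].
have -> : zr R Z0 = 0 by [].
by rewrite /bump /= !(addn0, add1n) !divr1; ring.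
Qed.

Lemma table_incidence T U N : 0 < zr R N -> pair_check T U N ->
  incidence_pair I24 (table_mx T (Zpos xH)) (table_mx U N).
Proof.
move=> N0 check i j; rewrite dotv_table.
have := all_iota (all_iota check i) j; rewrite /I24; case: ifP => _.
  by move=> /Z.eqb_spec ->; rewrite divff // gt_eqF.
by move=> /(zr_lt R) lt; rewrite ltr_pdivrMr // mul1r.
Qed.

Lemma cell24_conv : conv (table_mx vertex24 (Zpos xH)) = @cell24 R.
Proof.
have one : zr R (Zpos xH) = 1 by [].
have gen : range (fun i => col i (table_mx vertex24 (Zpos xH))) =
    [set x | exists (i j : 'I_4) (s t : bool), (i < j)%N /\
      x = (-1) ^+ s *: delta_mx i ord0 + (-1) ^+ t *: delta_mx j ord0] :> set 'cV[R]_4.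
  pose sg (b : bool) : Z := if b then Zneg xH else Zpos xH.
  pose e (i j : nat) s t (r : nat) : Z :=
    Z.add (if r == i then sg s else Z0) (if r == j then sg t else Z0).
  have eE (i j : 'I_4) s t (k : 'I_24) :
      (forall r : 'I_4, coordZ vertex24 k r = e i j s t r) ->
      col k (table_mx vertex24 (Zpos xH)) =
      (-1) ^+ s *: delta_mx i ord0 + (-1) ^+ t *: delta_mx j ord0 :> 'cV[R]_4.
    move=> kE; apply/colP => r; rewrite !mxE kE zrD one divr1 eqxx !andbT.
    by rewrite !(fun_if (zr R)) -!val_eqE /=; congr (_ + _); case: ifP => _;
      case: (s) (t) => -[]; rewrite ?mulr0 ?mulr1 ?expr0 ?expr1.
  pose match_check (k i j : nat) (s t : bool) :=
    all (fun r => Z.eqb (coordZ vertex24 k r) (e i j s t r)) (iota 0 4).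
  have matchP (k : 'I_24) (i j : 'I_4) s t : match_check k i j s t ->
      forall r : 'I_4, coordZ vertex24 k r = e i j s t r.
    by move=> /all_iota mk r; exact/Z.eqb_spec.
  apply/seteqP; split=> [_ [k _ <-]|_ [i [j [s [t [ij ->]]]]]].
    have : all (fun k => has (fun i => has (fun j => has (fun s => has (fun t =>
        (i < j)%N && match_check k i j s t) [:: false; true]) [:: false; true])
        (iota 0 4)) (iota 0 4)) (iota 0 24) by vm_compute.
    move=> /all_iota/(_ k)/has_iota[i]/has_iota[j]/hasP[s _]/hasP[t _]/andP[ij mk].
    by exists i, j, s, t; split=> //; apply: eE; exact: matchP.
  have : all (fun i => all (fun j => all (fun s => all (fun t => (i < j)%N ==>
      has (fun k => match_check k i j s t) (iota 0 24)) [:: false; true])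
      [:: false; true]) (iota 0 4)) (iota 0 4) by vm_compute.
  have bools b : b \in [:: false; true] by case: b.
  move=> /all_iota/(_ i)/all_iota/(_ j)/allP/(_ s (bools s))/allP/(_ t (bools t)).
  move=> /implyP/(_ ij).
  by move=> /has_iota[k mk]; exists k => //; apply: eE; exact: matchP.
by rewrite /conv gen.
Qed.

End Tables.

Definition common (i k : nat) : seq nat := [seq j <- iota 0 24 | inc24 i j && inc24 k j].

Lemma mem_common i k j : (j \in common i k) = [&& inc24 i j, inc24 k j & (j < 24)%N].
Proof. by rewrite /common mem_filter mem_iota add0n -andbA. Qed.

(** Two vertices of the 24-cell span an edge when exactly three facets contain
    both. *)
Definition nbr (i k : nat) : bool := size (common i k) == 3%N.

(** Among the three facets [js] through an edge at [i], the neighbour [k] of [i]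
    leaves only the one numbered [l]: these are the vertices next to the edge in
    the cube that is the vertex figure at [i]. *)
Definition omits_facet (i : nat) (js : seq nat) (l k : nat) : bool :=
  all (fun l' => inc24 k (nth 0%N js l') == (l != l')) (iota 0 3) && nbr i k.

Lemma frame_check24 : all (fun i => all (fun k => nbr i k ==> (k != i) &&
    all (fun l => has (omits_facet i (common i k) l) (iota 0 24)) (iota 0 3)) (iota 0 24)) (iota 0 24).
Proof. by vm_compute. Qed.

Lemma frame24 (i k : 'I_24) : nbr i k ->
  exists (jf : 'I_3 -> 'I_24) (kf : 'I_3 -> 'I_24), [/\ corner_frame I24 i k jf kf,
    forall l, nbr i (kf l) & forall j : 'I_24, I24 i j -> I24 k j -> exists l, jf l = j].
Proof.
move=> ik.
have := frame_check24.
move=> /all_iota/(_ i)/all_iota/(_ k)/implyP/(_ ik)/andP[ki /all_iota opp].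
have /choice[kf kfP] : forall l : 'I_3, exists k' : 'I_24, omits_facet i (common i k) l k'.
  by move=> l; apply: has_iota; exact: opp.
have c24 l : (l < 3)%N -> nth 0%N (common i k) l \in common i k.
  by move=> l3; rewrite mem_nth // (eqP ik).
have clt l : (l < 3)%N -> (nth 0%N (common i k) l < 24)%N.
  by move=> /c24; rewrite mem_common => /and3P[].
have [jf jfE] : exists jf : 'I_3 -> 'I_24, forall l : 'I_3, jf l = nth 0%N (common i k) l :> nat.
  by exists (fun l : 'I_3 => Ordinal (clt l (ltn_ord l))).
have jfc (l : 'I_3) : [&& inc24 i (jf l), inc24 k (jf l) & (jf l < 24)%N].
  by rewrite -mem_common jfE c24 ?ltn_ord.
exists jf, kf; split=> [|l|j Iij Ikj]; last 2 first.
- by have /andP[] := kfP l.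
- have jc : (j : nat) \in common i k by rewrite mem_common ltn_ord andbT; apply/andP.
  have [l lE] : exists l : 'I_3, index (j : nat) (common i k) = l.
    have l3 : (index (j : nat) (common i k) < 3)%N.
      by apply: leq_trans (eq_leq (eqP ik)); rewrite index_mem.
    exact: ord_of_lt l3.
  by exists l; apply: ord_inj; rewrite jfE -lE (nth_index _ jc).
split=> [|l|l|l l'].
- by move: ki; rewrite val_eqE.
- by have /and3P[] := jfc l.
- by have /and3P[] := jfc l.
- by have /andP[/all_iota/(_ l')/eqP + _] := kfP l; rewrite -jfE.
Qed.

Lemma corner_simple24 : @corner_simple 3 24 24 I24.
Proof.
split.
- by exists ord0.
- have : all (fun i => all (fun k => all (fun j => inc24 i j ==> inc24 k j) (iota 0 24)
    ==> (k == i)) (iota 0 24)) (iota 0 24) by vm_compute.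
  move=> chk i k ik; have /implyP := all_iota (all_iota chk i) k; rewrite val_eqE.
  move=> h; apply/eqP/h/allP => j; rewrite mem_iota add0n => j24; apply/implyP.
  exact: (ik (Ordinal j24)).
- have : all (fun j => all (fun k => all (fun i => inc24 i j ==> inc24 i k) (iota 0 24)
    ==> (k == j)) (iota 0 24)) (iota 0 24) by vm_compute.
  move=> chk j k jk; have /implyP := all_iota (all_iota chk j) k; rewrite val_eqE.
  move=> h; apply/eqP/h/allP => i; rewrite mem_iota add0n => i24; apply/implyP.
  exact: (jk (Ordinal i24)).
- have : all (fun i => has (fun j => ~~ inc24 i j) (iota 0 24)) (iota 0 24) by vm_compute.
  by move=> /all_iota chk i; have [j ij] := has_iota (chk i); exists j.
- have : all (fun i => has (nbr i) (iota 0 24)) (iota 0 24) by vm_compute.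
  move=> /all_iota chk i; exists (fun k : 'I_24 => nbr i k); split.
    by have [k ik] := has_iota (chk i); exists k.
  by move=> k /frame24[jf [kf [fr nk _]]]; exists jf, kf.
- have : all (fun j => has (fun i => has (fun k => [&& nbr i k, inc24 i j & inc24 k j])
    (iota 0 24)) (iota 0 24)) (iota 0 24) by vm_compute.
  move=> /all_iota chk j; have [i /has_iota[k /and3P[ik Iij Ikj]]] := has_iota (chk j).
  have [jf [kf [fr _ /(_ j Iij Ikj)[l lj]]]] := frame24 ik.
  by exists i, k, jf, kf, l.
Qed.

(** * Relabelling and the two bounds *)

Section Relabel.
Variables (n m : nat) (sv sv' : 'I_n -> 'I_n) (sf sf' : 'I_m -> 'I_m).
Hypotheses (svK : cancel sv sv') (svK' : cancel sv' sv).
Hypotheses (sfK : cancel sf sf') (sfK' : cancel sf' sf).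

Lemma corner_simple_relabel d (I : 'I_n -> 'I_m -> bool) :
  corner_simple d I -> corner_simple d (fun i j => I (sv i) (sf j)).
Proof.
have frameT i k (jf : 'I_d -> 'I_m) kf : corner_frame I i k jf kf ->
    corner_frame (fun i j => I (sv i) (sf j)) (sv' i) (sv' k) (sf' \o jf) (sv' \o kf).
  move=> [ki Ii Ik Ikf]; split=> [|l|l|l l'] /=; rewrite ?svK' ?sfK' //.
  by rewrite (inj_eq (can_inj svK')).
case=> [[i0 _] vinc finc univ nbrs facets]; split.
- by exists (sv' i0).
- move=> i k ik; apply: (can_inj svK); apply: vinc => j Iij.
  by have := ik (sf' j); rewrite sfK'; apply.
- move=> j k jk; apply: (can_inj sfK); apply: finc => i Iij.
  by have := jk (sv' i); rewrite svK'; apply.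
- by move=> i; have [j ij] := univ (sv i); exists (sf' j); rewrite sfK'.
- move=> i; have [N [[k Nk] Nf]] := nbrs (sv i); exists (N \o sv).
  split; first by exists (sv' k); rewrite /= svK'.
  move=> k' /Nf[jf [kf [fr Nkf]]]; exists (sf' \o jf), (sv' \o kf); split.
    by have := frameT _ _ _ _ fr; rewrite !svK.
  by move=> l; rewrite /= svK'.
- move=> j; have [i [k [jf [kf [l [fr jl]]]]]] := facets (sf j).
  exists (sv' i), (sv' k), (sf' \o jf), (sv' \o kf), l; split; first exact: frameT.
  by rewrite /= jl sfK.
Qed.

End Relabel.

Lemma mem_grid a b p : p \in allpairs pair (iota 0 a) (iota 0 b) -> (p.1 < a)%N /\ (p.2 < b)%N.
Proof.
by move=> /allpairsP[[i j] [i_in j_in ->]]; move: i_in j_in; rewrite !mem_iota !add0n.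
Qed.

Section Labels.
Variables (sv sv' sf sf' : 'I_24 -> 'I_24).
Hypotheses (svK : cancel sv sv') (svK' : cancel sv' sv).
Hypotheses (sfK : cancel sf sf') (sfK' : cancel sf' sf).
Local Notation I := (fun i j => I24 (sv i) (sf j)).

(** The numbering of [construction24], carried over to a labelling in which the
    vertex [i] and the facet [j] have the standard numbers [sv i] and
    [sf j]. *)
Definition decode (x : nat) : element 24 24 :=
  if (x < 24)%N then inl (sv' (inord x)) else inr (sf' (inord (x - 24))).

Definition encode (e : element 24 24) : nat :=
  match e with inl i => sv i | inr j => 24 + sf j end.

Lemma decodeK x : (x < 48)%N -> encode (decode x) = x.
Proof.
rewrite /decode => x48; case: ltnP => x24 /=; first by rewrite svK' inordK.
by rewrite sfK' inordK ?subnKC // ltn_subLR.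
Qed.

Lemma encodeK : cancel encode decode.
Proof.
case=> k; rewrite /decode /encode; first by rewrite ltn_ord inord_val svK.
by rewrite ltnNge leq_addr /= addKn inord_val sfK.
Qed.

Lemma encode_lt e : (encode e < 48)%N.
Proof.
case: e => k /=; first by rewrite (leq_trans (ltn_ord _)).
by rewrite -[48%N]/(24 + 24)%N ltn_add2l.
Qed.

Definition incident24 (x y : nat) : bool :=
  if (x < 24)%N then (24 <= y)%N && inc24 x (y - 24)
  else (y < 24)%N && inc24 y (x - 24).

Definition nonincident24 (x y : nat) : bool :=
  if (x < 24)%N then (24 <= y)%N && ~~ inc24 x (y - 24)
  else (y < 24)%N && ~~ inc24 y (x - 24).

Lemma incidentE x y : (x < 48)%N -> (y < 48)%N ->
  incident I (decode x) (decode y) = incident24 x y.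
Proof.
move=> x48 y48; rewrite /incident24 /decode.
case: ltnP => x24; case: ltnP => y24 //=; rewrite /I24 ?svK' ?sfK' !inordK //.
  by rewrite ltn_subLR.
by rewrite ltn_subLR.
Qed.

Lemma nonincidentE x y : (x < 48)%N -> (y < 48)%N ->
  nonincident I (decode x) (decode y) = nonincident24 x y.
Proof.
move=> x48 y48; rewrite /nonincident24 /decode.
case: ltnP => x24; case: ltnP => y24 //=; rewrite /I24 ?svK' ?sfK' !inordK //.
  by rewrite ltn_subLR.
by rewrite ltn_subLR.
Qed.

Definition separated24 (y : nat) (ys : seq nat) : bool :=
  has (fun w => nonincident24 w y && all (incident24 w) ys) (iota 0 48).
Arguments separated24 : simpl never.

Definition complete24 (done : seq nat) : bool := all (fun x => x \in done) (iota 0 48).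
Arguments complete24 : simpl never.

Fixpoint peel24 (ys : seq nat) : bool :=
  if ys is y :: ys' then
    ((ys' == [::]) || separated24 y ys') && peel24 ys'
  else true.

(** The computable form of [construction_wf], with a search for the peeling
    vector in place of the existential quantifier. *)
Fixpoint wf24 (done : seq nat) (s : seq (nat * seq nat)) : bool :=
  if s is (x, ys) :: s' then
    [&& (x < 48)%N, x \notin done, all (fun y => (y < 48)%N) ys, all (incident24 x) ys,
        peel24 ys, all (fun y => y \in done) ys & wf24 (x :: done) s']
  else complete24 done.

Definition decode_step (t : nat * seq nat) := (decode t.1, map decode t.2).

Lemma peel24P ys : all (fun y => (y < 48)%N) ys -> peel24 ys -> peelable I (map decode ys).
Proof.
elim: ys => [//|y ys IH] /= /andP[y48 ys48] /andP[yw yp]; split; last exact: IH.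
case/orP: yw => [/eqP->|/hasP[w + /andP[wy wys]]]; first by left.
rewrite mem_iota add0n => /andP[_ w48]; right; exists (decode w).
rewrite nonincidentE // wy /= all_map; apply/allP => z zys /=.
by rewrite incidentE ?(allP wys) // (allP ys48).
Qed.

Lemma wf24P done s : all (fun y => (y < 48)%N) done -> wf24 done s ->
  construction_wf I (map decode done) (map decode_step s).
Proof.
elim: s done => [|[x ys] s IH] done done48 /=.
  move=> /allP alldone e; rewrite -(encodeK e); apply: map_f.
  by apply: alldone; rewrite mem_iota add0n encode_lt.
move=> /and5P[x48 xdone ys48 xys /and3P[ysp ysdone swf]]; split.
- apply/negP => /mapP[y ydone xy]; case/negP: xdone.
  by rewrite -(decodeK x48) xy decodeK // (allP done48).
- by rewrite all_map; apply/allP => y yys /=; rewrite incidentE ?(allP xys) // (allP ys48).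
- exact: peel24P.
- by move=> _ /mapP[y yys ->]; apply: map_f; exact: (allP ysdone).
- by apply: (IH (x :: done)); rewrite //= x48.
Qed.

Lemma construction24_wf : wf24 [::] construction24.
Proof. by vm_compute. Qed.

Lemma construction24_size : sumn [seq 4 - size t.2 | t <- construction24]%N = 52%N.
Proof. by vm_compute. Qed.

Lemma prime_chain24_le (R : realType) l (P : 'I_l.+1 -> {pred {mpoly R[4 * (24 + 24)]}}) :
  prime_chain (vanishing_ideal (@pair_space R 3 24 24 I)) P -> (l <= 52)%N.
Proof.
apply: (@construction_chain_le R 3 24 24 I (map decode_step construction24)).
  exact: (@wf24P [::] construction24 isT construction24_wf).
by rewrite size_slots -map_comp -[RHS]construction24_size; congr sumn.
Qed.

Section Generic.
Variable R : realType.

Definition gen_point : 'rV[R]_(4 * (24 + 24)) :=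
  mxvec (row_mx (\matrix_(r, i) table_mx R vertex_gen (Zpos xH) r (sv i))
                (\matrix_(r, j) table_mx R facet_gen (Zpos 10) r (sf j))).

Lemma gen_vertex i : vec_of gen_point (inl i) = col (sv i) (table_mx R vertex_gen (Zpos xH)).
Proof. by apply/colP => r; rewrite /vec_of /gen_point mxvecK row_mxKl !mxE. Qed.

Lemma gen_facet j : vec_of gen_point (inr j) = col (sf j) (table_mx R facet_gen (Zpos 10)).
Proof. by apply/colP => r; rewrite /vec_of /gen_point mxvecK row_mxKr !mxE. Qed.

Lemma zr10 : 0 < zr R (Zpos 10).
Proof. by rewrite /zr ltr0z. Qed.

Lemma gen_pair_space : pair_space I gen_point.
Proof.
move=> i j; have := table_incidence zr10 pair_check_gen (sv i) (sf j).
by rewrite -gen_vertex -gen_facet.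
Qed.

(** The integer equations are those of the stress multiplied by the denominators
    1 and 10 of the two tables. *)
Lemma stress_free_elim M (prs : seq (nat * nat)) (pr : 'I_M -> 'I_24 * 'I_24)
    (w : 'I_M -> R) : size prs = M ->
  (forall e, (sv (pr e).1 : nat, sf (pr e).2 : nat) = nth (0, 0)%N prs e) ->
  elim M (stress_eqs prs vertex_gen facet_gen) ->
  (forall i t, \sum_(e | (pr e).1 == i) w e * vec_of gen_point (inr (pr e).2) t ord0 = 0) ->
  (forall j t, \sum_(e | (pr e).2 == j) w e * vec_of gen_point (inl (pr e).1) t ord0 = 0) ->
  forall e, w e = 0.
Proof.
move=> szp prE El wf wv e.
pose w' k := if insub k is Some e' then w e' else 0.
have w'E (e' : 'I_M) : w' e' = w e' by rewrite /w' valK.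
rewrite -w'E; apply: (elim_sound El) => // row.
have z0 : zr R Z0 = 0 by [].
have linE (f : nat * nat -> Z) : lin [seq f p | p <- prs] w' =
    \sum_(e' < M) zr R (f (sv (pr e').1 : nat, sf (pr e').2 : nat)) * w e'.
  rewrite lin_sum size_map szp; apply: eq_bigr => e' _.
  by rewrite (nth_map (0, 0)%N) ?szp // -prE w'E.
rewrite /stress_eqs mem_cat => /orP[] /mapP[[i' t'] /mem_grid[i24 t4] ->];
  rewrite linE /=.
  pose i0 := sv' (Ordinal i24).
  transitivity (zr R (Zpos 10) * \sum_(e' | (pr e').1 == i0) w e' *
      vec_of gen_point (inr (pr e').2) (Ordinal t4) ord0); last by rewrite wf mulr0.
  rewrite mulr_sumr [RHS]big_mkcond; apply: eq_bigr => e' _.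
  have -> : ((pr e').1 == i0) = ((sv (pr e').1 : nat) == i').
    by rewrite -(inj_eq (can_inj svK)) /i0 svK' -val_eqE.
  case: ifP => _; last by rewrite z0 mul0r.
  rewrite gen_facet !mxE /= mulrCA [_ * (_ / _)]mulrC divfK ?gt_eqF ?zr10 //.
  by rewrite mulrC.
pose j0 := sf' (Ordinal i24).
transitivity (\sum_(e' | (pr e').2 == j0) w e' *
    vec_of gen_point (inl (pr e').1) (Ordinal t4) ord0); last exact: wv.
rewrite [RHS]big_mkcond; apply: eq_bigr => e' _.
have -> : ((pr e').2 == j0) = ((sf (pr e').2 : nat) == i').
  by rewrite -(inj_eq (can_inj sfK)) /j0 sfK' -val_eqE.
case: ifP => _; last by rewrite z0 mul0r.
by rewrite gen_vertex !mxE /= divr1 mulrC.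
Qed.

Lemma prime_chain24_exists : exists P : 'I_49 -> {pred {mpoly R[4 * (24 + 24)]}},
  prime_chain (vanishing_ideal (@pair_space R 3 24 24 I)) P.
Proof.
have szp : size pairs24 = 144 by vm_compute.
have nthP (e : 'I_144) : exists ij : 'I_24 * 'I_24, (ij.1 : nat, ij.2 : nat) = nth (0, 0)%N pairs24 e
    /\ I24 ij.1 ij.2.
  have : nth (0, 0)%N pairs24 e \in pairs24 by rewrite mem_nth // szp.
  rewrite mem_filter; move: (nth _ _ _) => p /andP[p_inc /mem_grid[i24 j24]].
  exists (Ordinal i24, Ordinal j24); split; last exact: p_inc.
  by rewrite /= -surjective_pairing.
have [q qP] := choice nthP.
pose pr e := (sv' (q e).1, sf' (q e).2).
have [|||||P chainP] := @stress_free_prime_chain R 3 24 24 144 I pr gen_point.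
- by move=> e /=; rewrite svK' sfK'; case: (qP e).
- move=> i j Iij.
  have inp : (sv i : nat, sf j : nat) \in pairs24.
    rewrite mem_filter; apply/andP; split; first exact: Iij.
    by apply/allpairsP; exists (sv i : nat, sf j : nat); rewrite !mem_iota !add0n !ltn_ord.
  have i144 : (index (sv i : nat, sf j : nat) pairs24 < 144)%N.
    by apply: leq_trans (eq_leq szp); rewrite index_mem.
  have [e eE] := ord_of_lt i144.
  exists e; have [qe _] := qP e; rewrite -eE nth_index // in qe.
  rewrite /pr; case: (q e) qe => a b /= [/ord_inj-> /ord_inj->].
  by rewrite svK sfK.
- exact: gen_pair_space.
- move=> w; apply: (stress_free_elim szp _ stress_eqs_elim) => e.
  by rewrite /= svK' sfK'; case: (qP e).
- by [].
by exists P.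
Qed.

End Generic.
End Labels.

(** A bounded nonempty set of lengths has a maximum, which is the dimension. *)
Lemma krull_dim_between (A : comNzRingType) (J : set A) (lo hi : nat) :
  (exists P : 'I_lo.+1 -> {pred A}, prime_chain J P) ->
  (forall l (P : 'I_l.+1 -> {pred A}), prime_chain J P -> (l <= hi)%N) ->
  exists2 l, quotient_krull_dim J l & (lo <= l <= hi)%N.
Proof.
move=> lower upper.
pose Q l := `[< exists P : 'I_l.+1 -> {pred A}, prime_chain J P >].
have exQ : exists l, Q l by exists lo; exact/asboolP.
have Qle l : Q l -> (l <= hi)%N by move=> /asboolP[P]; exact: upper.
case: (ex_maxnP exQ Qle) => l Ql lmax; exists l.
  split=> [|l' P chainP]; first exact/asboolP.
  by apply: lmax; apply/asboolP; exists P.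
by rewrite Qle // andbT; apply: lmax; exact/asboolP.
Qed.

Section Labelling.
Variables (R : realType) (V : 'M[R]_(4, 24)) (F : 'I_24 -> set 'cV[R]_4).
Hypotheses (labeledVF : labeled_polytope V F) (convV : conv V = @cell24 R).

Local Notation V24 := (table_mx R vertex24 (Zpos xH)).
Local Notation A24 := (table_mx R facet24 (Zpos 2)).

Lemma pair24 : incidence_pair I24 V24 A24.
Proof. by apply: table_incidence pair_check24; rewrite /zr ltr0z. Qed.

(** The given polytope and the tables describe the same convex set, whose vertices
    and facets are intrinsic, so two labellings differ by permutations. *)
Lemma labelling : exists sv sv' sf sf' : 'I_24 -> 'I_24,
  [/\ cancel sv sv', cancel sv' sv, cancel sf sf', cancel sf' sf &
      (forall i, col i V = col (sv i) V24) /\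
      (forall j, F j = facet_of_col (conv V) A24 (sf j))].
Proof.
have [_ V24inj V24v A24inj A24f] := incidence_labeled corner_simple24 pair24.
have [_ Vinj Vv Finj Ff] := labeledVF.
have convE : conv V = conv V24 by rewrite convV cell24_conv.
have /choice[sv svE] i : exists k, col i V = col k V24.
  by apply/V24v; rewrite -convE; apply/Vv; exists i.
have /choice[sf sfE] j : exists k, F j = facet_of_col (conv V) A24 k.
  by rewrite convE; apply/A24f; rewrite -convE; apply/Ff; exists j.
have svinj : injective sv.
  by move=> i k ik; apply: Vinj; rewrite /= !svE ik.
have sfinj : injective sf by move=> j k jk; apply: Finj; rewrite !sfE jk.
by exists sv, (invF svinj), sf, (invF sfinj); split=> //;
  [exact: invF_f|exact: f_invF|exact: invF_f|exact: f_invF].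
Qed.

End Labelling.

Theorem theorem5p7 (R : realType)
    (V : 'M[R]_(4, 24)) (F : 'I_24 -> set 'cV[R]_4)
    (labeledVF : labeled_polytope V F)
    (convV : conv V = @cell24 R) :
  exists l : nat,
    semialg_dim [set mxvec M | M in centered_realization_space V F] l /\
    (48 <= l <= 52)%N.
Proof.
have [sv [sv' [sf [sf' [svK svK' sfK sfK' [svE sfE]]]]]] := labelling labeledVF convV.
pose I i j := I24 (sv i) (sf j).
pose A : 'M[R]_(4, 24) := \matrix_(r, j) table_mx R facet24 (Zpos 2) r (sf j).
have AE j : col j A = col (sf j) (table_mx R facet24 (Zpos 2)).
  by apply/colP => r; rewrite !mxE.
have IVA : incidence_pair I V A.
  by move=> i j; rewrite svE AE; exact: (pair24 R).
have FE : F = facet_of_col (conv V) A.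
  apply/funext => j; rewrite sfE; apply/seteqP.
  by split=> x [Vx]; rewrite dotv_col => xj; split=> //; rewrite dotv_col -xj ?AE.
have Isimple : corner_simple 3 I := corner_simple_relabel svK svK' sfK sfK' corner_simple24.
have -> : [set mxvec M | M in centered_realization_space V F] = @pair_space R 3 24 24 I.
  rewrite FE; apply/seteqP; split=> [_ [M /(centered_realization_spaceE Isimple IVA) IM <-]|x Ix].
    by rewrite /pair_space /= mxvecK.
  by exists (vec_mx x); [apply/(centered_realization_spaceE Isimple IVA)|rewrite vec_mxK].
have [l ldim lbound] := krull_dim_between (prime_chain24_exists svK svK' sfK sfK' R)
  (@prime_chain24_le sv sv' sf sf' svK svK' sfK sfK' R).
by exists l.
Qed.
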